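(* Let $\varphi$ be a random dynamical system generated by the Arratia flow, i.e. a random dynamical system corresponding (as defined in the context) to the Arratia flow with drift $a=0$. Then $\varphi$ has no stationary point.
   Context: **Stochastic flow.** A stochastic flow on $\mathbb{R}$ is a family $\{\psi_{s,t}:-\infty<s\le t<\infty\}$ of measurable random mappings of $\mathbb{R}$ such that: (1) for all $r\le s\le t$, $x\in\mathbb{R}$, $\omega\in\Omega$: $\psi_{s,t}(\omega,\psi_{r,s}(\omega,x))=\psi_{r,t}(\omega,x)$ and $\psi_{s,s}(\omega,x)=x$; (2) for $t_1<\dots<t_n$ the mappings $\psi_{t_1,t_2},\dots,\psi_{t_{n-1},t_n}$ are independent, and $\psi_{t_1,t_2}$ is equal in distribution to $\psi_{0,t_2-t_1}$. **Coalescing semigroups (driftless case).** Let $P^{(n),ind.}_t$ be the transition semigroup of $n$ independent Wiener processes on $\mathbb{R}^n$. A sequence $\{P^{(n)}_t:n\ge1\}$, with $P^{(n)}_t$ a transition semigroup on $\mathbb{R}^n$, is consistent if for all $t\ge 0$, $x\in\mathbb{R}^n$, $1\le i_1<\dots<i_k\le n$, Borel $B_k\subset\mathbb{R}^k$ and $C_n=\{y\in\mathbb{R}^n:(y_{i_1},\dots,y_{i_k})\in B_k\}$ one has $P^{(n)}_t(x,C_n)=P^{(k)}_t((x_{i_1},\dots,x_{i_k}),B_k)$. It is known that there is a unique consistent sequence of Feller transition semigroups $\{P^{(n),c}_t:n\ge 1\}$ (the coalescing transition semigroups), with $P^{(n),c}_t$ on $\mathbb{R}^n$, such that: (i) $P^{(2),c}_t((x,x),\Delta)=1$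 for all $x\in\mathbb{R}$, $t\ge0$, where $\Delta=\{(y,y):y\in\mathbb{R}\}$; (ii) for every $x\in\mathbb{R}^n$, if $X$ and $\tilde X$ are Feller processes started at $x$ with transition probabilities $P^{(n),c}_t$ and $P^{(n),ind.}_t$ respectively, and $\tau$, $\tilde\tau$ are the first times at which two of the coordinates of $X$, respectively $\tilde X$, coincide, then the stopped processes $X(\cdot\wedge\tau)$ and $\tilde X(\cdot\wedge\tilde\tau)$ have the same distribution. **Arratia flow.** A stochastic flow $\{\psi_{s,t}\}$ such that for all $s\in\mathbb{R}$, $n\ge1$, $x=(x_1,\dots,x_n)\in\mathbb{R}^n$ the process $t\mapsto(\psi_{s,s+t}(x_1),\dots,\psi_{s,s+t}(x_n))$, $t\ge0$, is a Feller process with starting point $x$ and transition probabilities $\{P^{(n),c}_t:t\ge0\}$ (coalescing Brownian motions, independent before meeting). **Random dynamical system generated by the Arratia flow.** A probability space $(\Omega,\mathcal{F},\mathbb{P})$ with a measurable group $(\theta_t)_{t\in\mathbb{R}}$ of measure-preserving transformations of $\Omega$ and a measurable mapping $\varphi:\mathbb{R}_+\times\Omega\times\mathbb{R}\to\mathbb{R}$ such that: (1) $\varphi(t+s,\omega,x)=\varphi(t,\theta_s\omega,\varphi(s,\omega,x))$ for all $s,t\ge0$, $\omega\in\Omega$, $x\in\mathbb{R}$; (2) $\psi_{s,t}(\omega,x)=\varphi(t-s,\theta_s\omega,x)$ defines an Arratia flow. The trajectories $t\mapsto\varphi(t,\omega,x)$ are continuous for all $\omega$ and $x$ (so that, by the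 cocycle property, all mappings $x\mapsto\psi_{s,t}(\omega,x)$ are non-decreasing). **Stationary point.** A random variable $\eta$ is a stationary point for $\varphi$ if there exists a set $\Omega_0\in\mathcal{F}$ of full measure which is forward-invariant ($\theta_t(\Omega_0)\subset\Omega_0$ for all $t\ge0$) such that for all $\omega\in\Omega_0$ and $t\ge0$: $\varphi(t,\omega,\eta(\omega))=\eta(\theta_t\omega)$. *)

(* Defs.v *)
From HB Require Import structures.
From mathcomp Require Import all_boot all_order all_algebra.
From mathcomp Require Import all_classical all_reals all_analysis.
Import Order.TTheory GRing.Theory Num.Theory.
Import numFieldNormedType.Exports.

Set Implicit Arguments.
Unset Strict Implicit.
Unset Printing Implicit Defensive.

Local Open Scope classical_set_scope.
Local Open Scope ring_scope.

(* The Euclidean space R^n is n.-tuple R, which the library equips with the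
   product of the Borel sigma-algebras. *)

Section transition_functions.
Context {R : realType}.

Definition subtuple n k (i : 'I_k -> 'I_n) (x : n.-tuple R) : k.-tuple R :=
  [tuple tnth x (i j) | j < k].

(* Tuples carry no topology in the library: continuity is expressed through
   row vectors, whose topology is the product topology. *)
Definition C0 n (f : n.-tuple R -> R) : Prop :=
  continuous (fun v : 'rV[R]_n => f [tuple v ord0 i | i < n]) /\
  forall e : R, 0 < e -> exists M : R, forall x : n.-tuple R,
    (exists i, M < `|tnth x i|) -> `|f x| < e.

Definition kernel_op n (K : R.-pker (n.-tuple R) ~> (n.-tuple R))
    (f : n.-tuple R -> R) (x : n.-tuple R) : R :=
  (\int[K x]_y f y)%R.

(* Families are indexed by all of R; only the indices t >= 0 matter. *)
Definition transition_semigroup n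
    (Q : R -> R.-pker (n.-tuple R) ~> (n.-tuple R)) : Prop :=
  (forall x B, measurable B -> Q 0 x B = \d_x B) /\
  (forall s t x B, 0 <= s -> 0 <= t -> measurable B ->
     Q (s + t) x B = (\int[Q s x]_y Q t y B)%E).

Definition Feller_semigroup n
    (Q : R -> R.-pker (n.-tuple R) ~> (n.-tuple R)) : Prop :=
  [/\ transition_semigroup Q,
      forall t f, 0 <= t -> C0 f -> C0 (kernel_op (Q t) f)
    & forall f, C0 f -> forall e : R, 0 < e -> exists2 h : R, 0 < h &
        forall t x, 0 <= t < h -> `|kernel_op (Q t) f x - f x| < e].

Definition consistent
    (Q : forall n, R -> R.-pker (n.-tuple R) ~> (n.-tuple R)) : Prop :=
  forall n k (i : 'I_k -> 'I_n) t x B,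
    (0 < k)%N -> {homo i : a b / (a < b)%N} -> 0 <= t -> measurable B ->
    Q n t x [set y | B (subtuple i y)] = Q k t (subtuple i x) B.

(* normal_prob takes the standard deviation and is not a Dirac mass when that
   deviation is 0. *)
Definition wiener1 (t x : R) : set R -> \bar R :=
  if t == 0 then \d_x else normal_prob x (Num.sqrt t).

Section wiener1_probability.
Variables t x : R.

Let wiener1_set0 : wiener1 t x set0 = 0%E.
Proof. by rewrite /wiener1; case: ifP => _; exact: measure0. Qed.

Let wiener1_ge0 A : (0 <= wiener1 t x A)%E.
Proof. by rewrite /wiener1; case: ifP => _; exact: measure_ge0. Qed.

Let wiener1_semi_sigma_additive : semi_sigma_additive (wiener1 t x).
Proof.
rewrite /wiener1; case: ifP => _; first exact: measure_semi_sigma_additive.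
exact: (@measure_semi_sigma_additive _ _ _ (normal_prob x (Num.sqrt t))).
Qed.

HB.instance Definition _ := isMeasure.Build _ _ _ (wiener1 t x)
  wiener1_set0 wiener1_ge0 wiener1_semi_sigma_additive.

Let wiener1_setT : wiener1 t x setT = 1%E.
Proof. by rewrite /wiener1; case: ifP => _; exact: probability_setT. Qed.

HB.instance Definition _ :=
  Measure_isProbability.Build _ _ _ (wiener1 t x) wiener1_setT.

End wiener1_probability.

Definition tcons n (p : R * n.-tuple R) : n.+1.-tuple R :=
  [tuple of p.1 :: p.2].

Lemma measurable_tcons n : measurable_fun setT (@tcons n).
Proof.
exact: (measurable_cons measurable_fst measurable_snd).
Qed.

HB.instance Definition _ n :=
  isMeasurableFun.Build _ _ _ _ (@tcons n) (@measurable_tcons n).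

(* Transition probability of n independent Wiener processes: the product of
   the measures wiener1 t x_i (see wiener_box). *)
Fixpoint wiener (t : R) n : n.-tuple R -> probability (n.-tuple R) R :=
  match n with
  | 0 => fun x => (\d_x : probability (0.-tuple R) R)
  | m.+1 => fun x => (distribution
      ((wiener1 t (thead x) \x wiener t [tuple of behead x])%E
        : probability (R * m.-tuple R)%type R)
      (@tcons m) : probability (m.+1.-tuple R) R)
  end.

Lemma wiener_box t n (x : n.-tuple R) (B : 'I_n -> set R) :
  (forall i, measurable (B i)) ->
  wiener t x [set y | forall i, B i (tnth y i)] =
  (\prod_(i < n) wiener1 t (tnth x i) (B i))%E.
Proof.
elim: n x B => [x B mB|n IH x B mB].
  rewrite big_ord0 /= diracE mem_set// => -[].
  by case.
rewrite big_ord_recl/= /distribution/= /pushforward/=.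
have -> : @tcons n @^-1` [set y | forall i, B i (tnth y i)] =
    B ord0 `*` [set y | forall i, B (lift ord0 i) (tnth y i)].
  apply/seteqP; split => [[a y] /= H|[a y] [/= H0 H] i].
    split => /= [|i]; first by have := H ord0; rewrite (tnth_nth 0).
    by have := H (lift ord0 i); rewrite !(tnth_nth 0).
  have [->|i0] := eqVneq i ord0; first by rewrite (tnth_nth 0).
  have [j ->] : exists j, i = lift ord0 j.
    by case: (unliftP ord0 i) i0 => [j -> _|-> /eqP//]; exists j.
  by have := H j; rewrite !(tnth_nth 0).
rewrite product_measure1E//; last first.
  have -> : [set y : n.-tuple R | forall i, B (lift ord0 i) (tnth y i)] =
      \bigcap_(i in [set: 'I_n]) (@tnth n R ^~ i @^-1` B (lift ord0 i)).
    by apply/seteqP; split => [y H i _|y H i]; [exact: H|exact: H].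
  apply: fin_bigcap_measurable => // i _.
  by rewrite -[X in measurable X]setTI; exact: measurable_tnth.
congr (_ * _)%E.
apply: etrans; first exact: (IH [tuple of behead x] (fun i => B (lift ord0 i))).
apply: eq_bigr => i _; congr (wiener1 _ _ _).
by rewrite [in RHS](tnth_nth 0) (tnth_nth 0) /= nth_behead.
Qed.

End transition_functions.

Section processes.
Context {R : realType}.

Section one_space.
Context {d} {T : measurableType d} (P : probability T R).

Definition natural_filtration n (X : R -> T -> n.-tuple R) (s : R) :
    set_system T :=
  <<s [set X u @^-1` B | u in [set u | 0 <= u <= s] & B in measurable] >>.

(* Conditional expectations are not in the library; the last clause is the
   defining property of P (X (s + t) \in B | F_s) = Q t (X s) B. Regularity of
   the paths is not built in: it is required where it matters. *)
Definition Feller_process n (Q : R -> n.-tuple R -> set (n.-tuple R) -> \bar R)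
    (x : n.-tuple R) (X : R -> T -> n.-tuple R) : Prop :=
  [/\ forall t, 0 <= t -> measurable_fun setT (X t),
      P [set w | X 0 w = x] = 1%E
    & forall s t A B, 0 <= s -> 0 <= t ->
        natural_filtration X s A -> measurable B ->
        P (A `&` X (s + t) @^-1` B) = (\int[P]_(w in A) Q t (X s w) B)%E].

Definition continuous_paths n (X : R -> T -> n.-tuple R) : Prop :=
  forall w i, {within `[0, +oo[, continuous (fun t => tnth (X t w) i)}.

(* +oo when no two coordinates ever meet *)
Definition meeting_time n (X : R -> T -> n.-tuple R) (w : T) : \bar R :=
  ereal_inf [set t%:E | t in [set t | 0 <= t /\
    exists i j, i != j /\ tnth (X t w) i = tnth (X t w) j]].

Definition stopped n (X : R -> T -> n.-tuple R) (t : R) (w : T) : n.-tuple R :=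
  X (fine (Order.min t%:E (meeting_time X w))) w.

End one_space.

(* equality of the finite-dimensional distributions *)
Definition same_law d d' (T : measurableType d) (T' : measurableType d')
    (P : probability T R) (P' : probability T' R) n
    (X : R -> T -> n.-tuple R) (X' : R -> T' -> n.-tuple R) : Prop :=
  forall m (t : 'I_m -> R) (B : set (m.-tuple (n.-tuple R))),
    (forall i, 0 <= t i) -> measurable B ->
    P [set w | B [tuple X (t i) w | i < m]] =
    P' [set w | B [tuple X' (t i) w | i < m]].

(* The semigroups are characterized by their defining properties. In the last
   clause the processes are taken with continuous paths, so that meeting times
   are attained and measurable. *)
Definition coalescing_semigroups
    (Q : forall n, R -> R.-pker (n.-tuple R) ~> (n.-tuple R)) : Prop :=
  [/\ forall n, (0 < n)%N -> Feller_semigroup (Q n),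
      consistent Q,
      forall t x, 0 <= t ->
        Q 2%N t [tuple x; x] [set y | tnth y ord0 = tnth y ord_max] = 1%E
    & forall n (x : n.-tuple R) d d' (T : measurableType d)
        (T' : measurableType d') (P : probability T R) (P' : probability T' R)
        (X : R -> T -> n.-tuple R) (X' : R -> T' -> n.-tuple R),
        (0 < n)%N ->
        Feller_process P (fun t y => Q n t y) x X -> continuous_paths X ->
        Feller_process P' (fun t y => wiener t y) x X' -> continuous_paths X' ->
        same_law P P' (stopped X) (stopped X')].

End processes.

Section flows.
Context {R : realType} {d} {T : measurableType d} (P : probability T R).

(* sigma-algebra generated by a random mapping of R, an element of the product
   space R^R *)
Definition mapping_sigma (f : T -> R -> R) : set_system T :=
  <<s [set (f ^~ x) @^-1` B | x in setT & B in measurable] >>.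

Definition independent m (G : 'I_m -> set_system T) : Prop :=
  forall (J : {set 'I_m}) (A : 'I_m -> set T), (forall i, G i (A i)) ->
    P (\bigcap_(i in [set` J]) A i) = (\prod_(i in J) P (A i))%E.

Definition same_mapping_law (f g : T -> R -> R) : Prop :=
  forall m (x : 'I_m -> R) (B : set (m.-tuple R)), measurable B ->
    P [set w | B [tuple f w (x i) | i < m]] =
    P [set w | B [tuple g w (x i) | i < m]].

(* psi s t is only meaningful for s <= t. *)
Definition stochastic_flow (psi : R -> R -> T -> R -> R) : Prop :=
  [/\ forall s t, s <= t ->
        measurable_fun setT (fun p : T * R => psi s t p.1 p.2),
      forall r s t x w, r <= s -> s <= t ->
        psi s t w (psi r s w x) = psi r t w x,
      forall s x w, psi s s w x = x,
      forall (t : nat -> R) m, {homo t : i j / (i < j)%N >-> i < j} ->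
        independent (fun i : 'I_m => mapping_sigma (psi (t i) (t i.+1)))
    & forall s t, s < t -> same_mapping_law (psi s t) (psi 0 (t - s))].

Definition Arratia_flow
    (Q : forall n, R -> R.-pker (n.-tuple R) ~> (n.-tuple R))
    (psi : R -> R -> T -> R -> R) : Prop :=
  stochastic_flow psi /\
  forall s n (x : n.-tuple R), (0 < n)%N ->
    Feller_process P (fun t y => Q n t y) x
      (fun t w => [tuple psi s (s + t) w (tnth x i) | i < n]).

Definition measure_preserving_group (theta : R -> T -> T) : Prop :=
  [/\ measurable_fun setT (fun p : R * T => theta p.1 p.2),
      forall w, theta 0 w = w,
      forall s t w, theta (s + t) w = theta s (theta t w)
    & forall t A, measurable A -> P (theta t @^-1` A) = P A].

(* phi t is only meaningful for t >= 0. *)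
Definition Arratia_rds
    (Q : forall n, R -> R.-pker (n.-tuple R) ~> (n.-tuple R))
    (theta : R -> T -> T) (phi : R -> T -> R -> R) : Prop :=
  [/\ measure_preserving_group theta,
      measurable_fun [set p : R * (T * R) | 0 <= p.1]
        (fun p : R * (T * R) => phi p.1 p.2.1 p.2.2),
      forall s t w x, 0 <= s -> 0 <= t ->
        phi (t + s) w x = phi t (theta s w) (phi s w x),
      Arratia_flow Q (fun s t w x => phi (t - s) (theta s w) x)
    & forall w x, {within `[0, +oo[, continuous (fun t => phi t w x)}].

Definition stationary_point (theta : R -> T -> T) (phi : R -> T -> R -> R)
    (eta : {RV P >-> R}) : Prop :=
  exists Omega0 : set T,
    [/\ measurable Omega0, P Omega0 = 1%E,
        forall t, 0 <= t -> theta t @` Omega0 `<=` Omega0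
      & forall w t, Omega0 w -> 0 <= t -> phi t w (eta w) = eta (theta t w)].

End flows.

(* Main.v *)
Require Import Defs.
From HB Require Import structures.
From mathcomp Require Import all_boot all_order all_algebra.
From mathcomp Require Import all_classical all_reals all_analysis.
From mathcomp Require Import measurable_realfun.
From mathcomp Require Import ring lra.
Import Order.TTheory GRing.Theory Num.Theory.
Import numFieldNormedType.Exports.
Set Implicit Arguments.
Unset Strict Implicit.
Unset Printing Implicit Defensive.
Local Open Scope classical_set_scope.
Local Open Scope ring_scope.

(** Trajectories of the flow cannot cross: two of them that meet stay together,
    so that x |-> phi t w x is nondecreasing ([phi_monotone]). Suppose that eta
    is stationary. Put c := N(0,1)(]1, +oo[) > 0 and choose M such that
    |eta| > M has probability less than c / 2. As the shift theta_t preserves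
    P, the event that |eta| <= M both at time 0 and at time t fails with
    probability less than c; on it,
      phi t w (- M) <= phi t w (eta w) = eta (theta t w) <= M.
    Hence phi t (- M) > M has probability less than c, for every t. But
    phi t (- M) is normal with mean - M and variance t, so that for
    t = (2 M)^2 this probability is equal to c: a contradiction.

    The work lies in the law of phi t x ([phi_law]). The hypothesis on the
    semigroups determines [Q 1] only by comparison with a Wiener process that
    has continuous paths, and such a process has to be exhibited
    ([brownian_motion_exists]). The construction is the midpoint method of
    Levy, in a recursive form. A seed is a pair of a standard normal variable,
    the increment of the process over a time interval, and of an independent
    uniform variable, a reserve of randomness. Two maps send a seed to the
    seeds of the two halves of the interval, independent and rescaled so as to
    have the same law ([seed_halves]). For the increments this is the
    invariance of the standard Gaussian measure of the plane under rotations
    ([gauss_rotation]); for the reserves it holds because the binary digits of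
    even rank and those of odd rank of a uniform variable are independent
    ([unif_split]).

    Iterating these maps gives, at each level n, a Gaussian random walk with
    time step 2^-n; the walk of level n + 1 extends that of level n, and its
    increments are independent of the past ([walk_increment_independent]). By
    the lemma of Borel and Cantelli the rescaled steps of level n are
    eventually bounded by 3 n, almost surely ([P_regular]), whence the walks
    converge, uniformly on bounded time intervals, to a continuous path
    ([continuous_path]). The independence of the increments and their law pass
    to the limit ([limit_independent], [path_increment_past]). *)

(** * Image measures *)

Lemma measurable_preimage d d' (T : measurableType d) (T' : measurableType d')
    (f : T -> T') (B : set T') :
  measurable_fun setT f -> measurable B -> measurable (f @^-1` B).
Proof. by move=> mf mB; rewrite -[X in measurable X]setTI; exact: mf. Qed.

(** With the proof of measurability of f among its arguments, the pushforward
    can be given wherever a measure is expected. *)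
Definition image_measure d d' (T : measurableType d) (T' : measurableType d')
    (R : realType) (m : {measure set T -> \bar R}) (f : T -> T')
    (mf : measurable_fun setT f) : {measure set T' -> \bar R} :=
  measure_function_pushforward__canonical__measure_function_Measure m mf.

(** * The Gaussian measure on the line *)

Section gaussian.
Context {R : realType}.
Implicit Types (a b c e m s x y v w : R) (A B : set R).
Local Notation mu := (@lebesgue_measure R).
Local Notation gauss := (@normal_prob R 0 1).
Local Notation pdf := (@normal_pdf R 0 1).

Definition affine a b : measurableTypeR R -> measurableTypeR R :=
  fun x => a * x + b.

Lemma measurable_affine a b : measurable_fun setT (affine a b).
Proof. exact: measurable_funD. Qed.

HB.instance Definition _ a b :=
  isMeasurableFun.Build _ _ _ _ (affine a b) (measurable_affine a b).

Lemma lebesgue_affine a b A : 0 < a -> measurable A ->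
  (a%:E * mu (affine a b @^-1` A) = mu A)%E.
Proof.
move=> a0 mA; apply/esym.
pose m := mscale (NngNum (ltW a0)) (image_measure mu (measurable_affine a b)).
apply: (@lebesgue_measure_unique R m) => // _ [[x y] _ <-].
rewrite -[RHS]/(a%:E * mu (affine a b @^-1` `]x, y]))%E.
have -> : affine a b @^-1` `]x, y] = `](x - b) / a, (y - b) / a]%classic.
  apply/seteqP; split => z /=;
  by rewrite /affine !in_itv/= ltr_pdivrMr// ler_pdivlMr// ltrBlDr lerBrDr mulrC.
rewrite !lebesgue_measure_itv/= !lte_fin ltr_pM2r ?invr_gt0// ltrD2r.
case: ifP => _; last by rewrite mule0.
by rewrite -!EFinB -EFinM; congr (_%:E); field; rewrite gt_eqF.
Qed.

Lemma ge0_integral_affine a b (f : R -> \bar R) : 0 < a ->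
  measurable_fun setT f -> (forall x, 0 <= f x)%E ->
  (a%:E * \int[mu]_x f (a * x + b)%R = \int[mu]_x f x)%E.
Proof.
move=> a0 mf f0.
have := ge0_integral_pushforward (measurable_affine a b) mu measurableT mf
  (fun x _ => f0 x).
rewrite preimage_setT => <-.
rewrite -[LHS](@ge0_integral_mscale _ _ _ (image_measure mu (measurable_affine a b)) setT
  measurableT (NngNum (ltW a0)))//.
by apply: eq_measure_integral => A mA _; exact: lebesgue_affine.
Qed.

(** The density is almost everywhere equal to the Radon-Nikodym derivative, for
    which the change of measure formula holds. *)
Lemma ge0_integral_gauss (f : R -> \bar R) :
  measurable_fun setT f -> (forall x, 0 <= f x)%E ->
  (\int[gauss]_x f x = \int[mu]_x (f x * (pdf x)%:E))%E.
Proof.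
move=> mf f0; have dom := @normal_prob_dominates R 0 1.
rewrite -(Radon_Nikodym_SigmaFinite.change_of_variables dom f0)//.
have intRN := Radon_Nikodym_SigmaFinite.f_integrable dom.
apply: ae_eq_integral => //.
- by apply: emeasurable_funM => //; exact: measurable_int intRN.
- apply: emeasurable_funM => //; apply/measurable_EFinP.
  exact: measurable_normal_pdf.
- apply: ae_eqe_mul2l; apply: integral_ae_eq => //=.
  + by apply/measurable_EFinP; exact: measurable_normal_pdf.
  + by move=> E _ mE; rewrite -Radon_Nikodym_SigmaFinite.f_integral.
Qed.

Lemma pdfE x : pdf x = normal_peak 1 * expR (- x ^+ 2 / 2).
Proof. by rewrite normal_pdfE ?oner_neq0// /normal_fun subr0 expr1n. Qed.

Lemma gauss_density A : measurable A ->
  gauss A = (\int[mu]_x (\1_A x * pdf x)%:E)%E.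
Proof.
move=> mA; rewrite -[A in LHS]setIT -integral_indic// ge0_integral_gauss//.
by apply/measurable_EFinP; exact: measurable_indic.
Qed.

Lemma normal_affine m s B : 0 < s -> measurable B ->
  normal_prob m s B = gauss ((fun z => m + s * z) @^-1` B).
Proof.
move=> s0 mB; have s_neq0 : s != 0 by rewrite gt_eqF.
have mpre : measurable ((fun z => m + s * z) @^-1` B).
  rewrite -[X in measurable X]setTI.
  have : measurable_fun setT (fun z => m + s * z).
    by apply: measurable_funD => //; exact: measurable_funM.
  exact.
have mpdf : measurable_fun setT (normal_pdf m s) := measurable_normal_pdf m s.
have mf : measurable_fun setT (fun x => (\1_B x * normal_pdf m s x)%:E).
  by apply/measurable_EFinP; apply: measurable_funM.
rewrite gauss_density// /normal_prob integral_mkcond.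
transitivity (\int[lebesgue_measure]_x (\1_B x * normal_pdf m s x)%:E)%E.
  apply: eq_integral => x _; rewrite /patch indicE.
  by case: ifPn => _; rewrite ?mul1r ?mul0r.
rewrite -(ge0_integral_affine m s0 mf); last first.
  by move=> x; rewrite lee_fin mulr_ge0// normal_pdf_ge0.
rewrite -ge0_integralZl//; first last.
- by rewrite lee_fin ltW.
- by move=> x _; rewrite lee_fin mulr_ge0// normal_pdf_ge0.
- have := measurableT_comp mf (measurable_affine s m).
  exact.
apply: eq_integral => z _; rewrite -EFinM; congr (_%:E).
rewrite mulrCA; congr (_ * _).
  by rewrite !indicE; congr (_%:R); apply: congr1; apply/idP/idP; rewrite !inE/= addrC.
rewrite pdfE normal_pdfE// /normal_fun addrK /normal_peak.
have -> : s ^+ 2 * pi *+ 2 = s ^+ 2 * (1 ^+ 2 * pi *+ 2) by rewrite expr1n mul1r mulrnAr.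
rewrite sqrtrM ?sqr_ge0// sqrtr_sqr ger0_norm ?ltW// invfM mulrA mulrA divff// mul1r.
congr (_ * expR _); rewrite exprMn -[s ^+ 2 *+ 2]mulr_natr.
by field.
Qed.

(** For e = 1 or e = -1, tilting the standard density by expR (e x) gives, up to
    the factor expR (1 / 2), the normal density with mean e. *)
Lemma gauss_ray_le e a A : e ^+ 2 = 1 -> measurable A ->
  (forall x, A x -> a <= e * x) -> (gauss A <= (expR (1 / 2 - a))%:E)%E.
Proof.
move=> e1 mA Aa.
pose pdf1 x := @normal_pdf R e 1 x.
have mpdf1 : measurable_fun setT (EFin \o pdf1).
  by apply/measurable_EFinP; exact: measurable_normal_pdf.
apply: (@le_trans _ _ (\int[mu]_(x in A) ((expR (1 / 2 - a))%:E * (pdf1 x)%:E))%E).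
  apply: ge0_le_integral => //.
  - by move=> x _; rewrite lee_fin normal_pdf_ge0.
  - apply: measurable_funTS; apply/measurable_EFinP; exact: measurable_normal_pdf.
  - by apply: measurable_funTS; apply: measurable_funeM.
  move=> x Ax; rewrite -EFinM lee_fin pdfE /pdf1 normal_pdfE ?oner_neq0// /normal_fun.
  rewrite mulrCA ler_pM2l ?normal_peak_gt0 ?oner_neq0// -expRD ler_expR.
  have := Aa _ Ax; move: e1; rewrite expr1n -mulr_natr mul1r !expr2 => e1 ?.
  have -> : (x - e) * (x - e) = x * x - 2 * (e * x) + e * e by ring.
  rewrite e1.
  by lra.
rewrite ge0_integralZl//; first last.
- by move=> x _; rewrite lee_fin normal_pdf_ge0.
- exact: measurable_funTS.
rewrite -[leRHS]mule1; apply: lee_pmul => //.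
- by apply: integral_ge0 => x _; rewrite lee_fin normal_pdf_ge0.
- exact: (@probability_le1 _ _ _ (normal_prob e 1)).
Qed.

(** The Chernoff bound with exponent 1. *)
Lemma gauss_tail a :
  (gauss [set x | (a < `|x|)%R] <= (2 * expR (1 / 2 - a))%:E)%E.
Proof.
have -> : [set x | a < `|x|] = `]a, +oo[%classic `|` `]-oo, (- a)%R[%classic.
  apply/seteqP; split => x /=; rewrite !in_itv/= andbT ltrNr ltr_normr.
    by case/orP => ?; [left|right].
  by case=> ->; rewrite ?orbT.
apply: (le_trans (measureU2 _ _ _)) => //.
rewrite mulr_natl mulr2n EFinD; apply: leeD.
  apply: (@gauss_ray_le 1) => //; first by rewrite expr1n.
  by move=> x /=; rewrite in_itv/= andbT mul1r => /ltW.
apply: (@gauss_ray_le (- 1)) => //; first by rewrite sqrrN expr1n.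
by move=> x /=; rewrite in_itv/= mulN1r ltrNr => /ltW.
Qed.

(** The two changes of variables replace y by v = c x + s y at fixed x, then x
    by w = s x - c y at fixed v. Their jacobians 1 / s and s cancel, and
    x^2 + y^2 = v^2 + w^2, so that the joint density keeps its form. *)
Lemma gauss_rotation c s (B C : set R) : 0 < s -> c ^+ 2 + s ^+ 2 = 1 ->
  measurable B -> measurable C ->
  ((gauss \x gauss) [set p | B (c * p.1 + s * p.2)%R /\ C (s * p.1 - c * p.2)%R]
   = gauss B * gauss C)%E.
Proof.
move=> s0 cs mB mC.
have mpdf : measurable_fun setT pdf := measurable_normal_pdf 0 1.
have mlin (a b : R) : measurable_fun setT (fun p : R * R => a * p.1 + b * p.2).
  by apply: measurable_funD; exact: measurable_funM.
have mlin' (a b : R) : measurable_fun setT (fun p : R * R => a * p.1 - b * p.2).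
  by apply: measurable_funB; exact: measurable_funM.
pose E := [set p : R * R | B (c * p.1 + s * p.2) /\ C (s * p.1 - c * p.2)].
have mE : measurable E.
  apply: measurableI.
    exact: (measurable_preimage (mlin c s) mB).
  exact: (measurable_preimage (mlin' s c) mC).
pose h x y : R := \1_B (c * x + s * y) * \1_C (s * x - c * y) * (pdf x * pdf y).
have h0 x y : 0 <= h x y by rewrite !mulr_ge0// normal_pdf_ge0.
have mh2 : measurable_fun setT (fun p : R * R => h p.1 p.2).
  apply: measurable_funM; apply: measurable_funM.
  - by apply: measurableT_comp; [exact: measurable_indic|exact: mlin].
  - by apply: measurableT_comp; [exact: measurable_indic|exact: mlin'].
  - exact: measurableT_comp.
  - exact: measurableT_comp.
have ->: (gauss \x gauss)%E E = (\int[mu]_x \int[mu]_y (h x y)%:E)%E.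
  rewrite /product_measure1 ge0_integral_gauss//=; last first.
    exact: measurable_fun_xsection.
  apply: eq_integral => x _.
  rewrite gauss_density; last exact: measurable_xsection.
  rewrite muleC -ge0_integralZl//; first last.
  - by rewrite lee_fin normal_pdf_ge0.
  - by move=> y _; rewrite lee_fin mulr_ge0// normal_pdf_ge0.
  - apply/measurable_EFinP; apply: measurable_funM => //.
    by apply: measurable_indic; exact: measurable_xsection.
  apply: eq_integral => y _; rewrite -EFinM; congr (_%:E).
  rewrite /h mulrCA; congr (_ * _).
  rewrite !indicE -natrM mulnb mem_xsection; congr (_ %:R).
  by apply: congr1; apply/idP/andP; rewrite !inE.
pose k (p : R * R) : R := s^-1 * h p.1 (s^-1 * p.2 + - (c / s * p.1)).
have mk : measurable_fun setT k.
  apply: measurable_funM => //.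
  have : measurable_fun setT (fun p : R * R => (p.1, s^-1 * p.2 + - (c / s * p.1))).
    apply: measurable_fun_pair => //; apply: measurable_funD.
      exact: measurable_funM.
    by apply: measurableT_comp => //; exact: measurable_funM.
  exact: (@measurableT_comp _ _ _ _ _ _ (fun p : R * R => h p.1 p.2)).
transitivity (\int[mu]_x \int[mu]_v (k (x, v))%:E)%E.
  apply: eq_integral => x _.
  rewrite -(@ge0_integral_affine (s^-1) (- (c / s * x)) (fun y => (h x y)%:E)).
  - rewrite -ge0_integralZl//; first last.
    + by rewrite lee_fin invr_ge0 ltW.
    + by move=> v _; rewrite lee_fin.
    + apply/measurable_EFinP.
      have : measurable_fun setT (fun v => (x, s^-1 * v - c / s * x)).
        by apply: measurable_fun_pair => //; apply: measurable_funD.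
      exact: (@measurableT_comp _ _ _ _ _ _ (fun p : R * R => h p.1 p.2)).
  - by rewrite invr_gt0.
  - apply/measurable_EFinP.
    have : measurable_fun setT (fun y : R => (x, y)) by exact: measurable_fun_pair.
    exact: (@measurableT_comp _ _ _ _ _ _ (fun p : R * R => h p.1 p.2)).
  - by move=> y; rewrite lee_fin.
have k0 p : 0 <= k p by rewrite mulr_ge0// invr_ge0 ltW.
rewrite (@fubini_tonelli _ _ _ _ _ mu mu (fun p => (k p)%:E)); first last.
  by move=> p; rewrite lee_fin.
  exact/measurable_EFinP.
transitivity (\int[mu]_v ((\1_B v * pdf v)%:E * gauss C))%E.
  apply: eq_integral => v _.
  rewrite -(@ge0_integral_affine s (c * v) (fun x => (k (x, v))%:E))//.
  - rewrite -ge0_integralZl//; first last.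
    + by rewrite lee_fin ltW.
    + by move=> w _; rewrite lee_fin.
    + apply/measurable_EFinP.
      have : measurable_fun setT (fun w => (s * w + c * v, v)).
        by apply: measurable_fun_pair => //; apply: measurable_funD.
      exact: measurableT_comp.
    rewrite gauss_density// -ge0_integralZl//; first last.
    + by rewrite lee_fin mulr_ge0// normal_pdf_ge0.
    + by move=> w _; rewrite lee_fin mulr_ge0// normal_pdf_ge0.
    + by apply/measurable_EFinP; apply: measurable_funM.
    apply: eq_integral => w _; rewrite -!EFinM; congr (_%:E).
    rewrite /k/= mulVKf ?gt_eqF// /h.
    have e1 : c * (s * w + c * v) + s * (s^-1 * v - c / s * (s * w + c * v)) = v.
      by field; rewrite gt_eqF.
    have e2 : s * (s * w + c * v) - c * (s^-1 * v - c / s * (s * w + c * v)) = w.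
      transitivity ((c ^+ 2 + s ^+ 2) * w + c / s * (c ^+ 2 + s ^+ 2 - 1) * v).
        by field; rewrite gt_eqF.
      by rewrite cs; ring.
    have e3 : s^-1 * v - c / s * (s * w + c * v) = s * v - c * w.
      transitivity (s * v - c * w + s^-1 * v * (1 - (c ^+ 2 + s ^+ 2))).
        by field; rewrite gt_eqF.
      by rewrite cs; ring.
    rewrite e1 e2 e3 [RHS]mulrACA; congr (_ * _).
    rewrite !pdfE mulrACA [RHS]mulrACA -!expRD; congr (_ * expR _).
    rewrite -!mulrDl -!opprD; congr (- _ / _).
    transitivity ((c ^+ 2 + s ^+ 2) * (v ^+ 2 + w ^+ 2)); first by ring.
    by rewrite cs mul1r.
  - apply/measurable_EFinP.
    have : measurable_fun setT (fun x : R => (x, v)) by exact: measurable_fun_pair.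
    exact: measurableT_comp.
  - by move=> y; rewrite lee_fin.
rewrite ge0_integralZr//.
- by rewrite -gauss_density.
- by apply/measurable_EFinP; apply: measurable_funM.
- by move=> v _; rewrite lee_fin mulr_ge0// normal_pdf_ge0.
Qed.

End gaussian.

(** * Limits of laws and independence *)

Section limit_law.
Context d d' (T : measurableType d) (T' : measurableType d') (R : realType).

(** Fatou's lemma for the events Y_n > a: if Y > a then Y_n > a eventually, and
    if Z_n > a infinitely often then Z >= a. *)
Lemma limit_law_le (m : {measure set T -> \bar R})
    (m' : {measure set T' -> \bar R}) (A : set T) (A' : set T')
    (Y_ : nat -> T -> R) (Y : T -> R) (Z_ : nat -> T' -> R) (Z : T' -> R) :
  measurable A -> measurable A' -> (m' A' < +oo)%E ->
  (forall n, measurable_fun setT (Y_ n)) -> measurable_fun setT Y ->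
  (forall n, measurable_fun setT (Z_ n)) -> measurable_fun setT Z ->
  (forall w, A w -> Y_ ^~ w @ \oo --> Y w) ->
  (forall w, A' w -> Z_ ^~ w @ \oo --> Z w) ->
  (forall n a, m (A `&` Y_ n @^-1` `]a, +oo[) =
               m' (A' `&` Z_ n @^-1` `]a, +oo[)) ->
  forall a, (m (A `&` Y @^-1` `]a, +oo[) <= m' (A' `&` Z @^-1` `[a, +oo[))%E.
Proof.
move=> mA mA' finA' mY_ mY mZ_ mZ cvgY cvgZ YZ a.
pose S N := A `&` \bigcap_(n in [set n | (N <= n)%N]) Y_ n @^-1` `]a, +oo[.
pose U N := A' `&` \bigcup_(n in [set n | (N <= n)%N]) Z_ n @^-1` `]a, +oo[.
have mS N : measurable (S N).
  apply: measurableI => //; apply: bigcap_measurable; first by exists N => /=.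
  by move=> n _; exact: measurable_preimage.
have mU N : measurable (U N).
  by apply: measurableI => //; apply: bigcup_measurable => n _; exact: measurable_preimage.
have cvgS : m (S N) @[N --> \oo] --> m (\bigcup_N S N).
  apply: nondecreasing_cvg_mu => //; first exact: bigcup_measurable.
  move=> i j ij; apply/subsetPset => w [Aw Sw]; split => // n /= jn.
  exact: Sw (leq_trans ij jn).
have cvgU : m' (U N) @[N --> \oo] --> m' (\bigcap_N U N).
  apply: nonincreasing_cvg_mu => //.
  - by rewrite (le_lt_trans _ finA')// le_measure ?inE//; exact: subIsetl.
  - by apply: bigcap_measurable => //; exists 0%N.
  - move=> i j ij; apply/subsetPset => w [A'w [n /= jn Zn]]; split => //.
    by exists n => //=; exact: leq_trans ij jn.
apply: (@le_trans _ _ (m (\bigcup_N S N))).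
  apply: le_measure; rewrite ?inE.
  - by apply: measurableI => //; exact: measurable_preimage.
  - exact: bigcup_measurable.
  move=> w [Aw /=]; rewrite in_itv/= andbT => aY.
  have [N _ HN] := cvgr_gt _ (cvgY _ Aw) _ aY.
  exists N => //; split => // n /= Nn.
  by rewrite in_itv/= andbT; exact: HN.
apply: (@le_trans _ _ (m' (\bigcap_N U N))); last first.
  apply: le_measure; rewrite ?inE.
  - by apply: bigcap_measurable => //; exists 0%N.
  - by apply: measurableI => //; exact: measurable_preimage.
  move=> w Uw; have [A'w _] := Uw 0%N I; split => //=.
  rewrite in_itv/= andbT leNgt; apply/negP => Za.
  have [N _ HN] := cvgr_lt _ (cvgZ _ A'w) _ Za.
  have [_ [n /= Nn]] := Uw N I; rewrite in_itv/= andbT => aZ.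
  by have := HN _ Nn; rewrite ltNge (ltW aZ).
rewrite -(cvg_lim _ cvgS)// -(cvg_lim _ cvgU)//; apply: lee_lim.
- by apply/cvg_ex; exists (m (\bigcup_N S N)).
- by apply/cvg_ex; exists (m' (\bigcap_N U N)).
near=> N; apply: (@le_trans _ _ (m (A `&` Y_ N @^-1` `]a, +oo[))).
  apply: le_measure; rewrite ?inE//.
    by apply: measurableI => //; exact: measurable_preimage.
  by move=> w [Aw Sw]; split=> //; apply: (Sw N) => /=.
rewrite YZ; apply: le_measure; rewrite ?inE//.
  by apply: measurableI => //; exact: measurable_preimage.
by move=> w [A'w Zw]; split => //; exists N => /=.
Unshelve. all: by end_near. Qed.

(** The ray ]a, +oo[ is the union of the rays ]a + 1 / (k + 1), +oo[, whose
    closures it contains. *)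
Lemma limit_law_lt (m : {measure set T -> \bar R})
    (m' : {measure set T' -> \bar R}) (A : set T) (A' : set T')
    (Y_ : nat -> T -> R) (Y : T -> R) (Z_ : nat -> T' -> R) (Z : T' -> R) :
  measurable A -> measurable A' -> (m' A' < +oo)%E ->
  (forall n, measurable_fun setT (Y_ n)) -> measurable_fun setT Y ->
  (forall n, measurable_fun setT (Z_ n)) -> measurable_fun setT Z ->
  (forall w, A w -> Y_ ^~ w @ \oo --> Y w) ->
  (forall w, A' w -> Z_ ^~ w @ \oo --> Z w) ->
  (forall n a, m (A `&` Y_ n @^-1` `]a, +oo[) =
               m' (A' `&` Z_ n @^-1` `]a, +oo[)) ->
  forall a, (m (A `&` Y @^-1` `]a, +oo[) <= m' (A' `&` Z @^-1` `]a, +oo[))%E.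
Proof.
move=> mA mA' finA' mY_ mY mZ_ mZ cvgY cvgZ YZ a.
pose S k := A `&` Y @^-1` `]a + k.+1%:R^-1, +oo[.
have mS k : measurable (S k) by apply: measurableI => //; exact: measurable_preimage.
have -> : A `&` Y @^-1` `]a, +oo[ = \bigcup_k S k.
  rewrite -setI_bigcupr -preimage_bigcup; congr (_ `&` _ @^-1` _).
  apply/seteqP; split => [x|x [k _]]; last first.
    by rewrite /= !in_itv/= !andbT; apply: lt_trans; rewrite ltrDl.
  rewrite itvoyEbigcup => -[k _]; rewrite /= in_itv/= andbT => kx.
  exists k.+1 => //=; rewrite in_itv/= andbT (lt_le_trans _ kx)// ltrD2l.
  by rewrite ltf_pV2 ?posrE// ltr_nat.
have cvgS : m (S k) @[k --> \oo] --> m (\bigcup_k S k).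
  apply: nondecreasing_cvg_mu => //; first exact: bigcup_measurable.
  move=> i j ij; apply/subsetPset => w [Aw /=]; rewrite in_itv/= andbT => Sw.
  split => //=; rewrite in_itv/= andbT (le_lt_trans _ Sw)//.
  by rewrite lerD2l lef_pV2 ?posrE// ler_nat.
rewrite -(cvg_lim _ cvgS)//; apply: lime_le.
  by apply/cvg_ex; exists (m (\bigcup_k S k)).
near=> k; apply: (le_trans (limit_law_le mA mA' finA' mY_ mY mZ_ mZ cvgY cvgZ YZ _)).
apply: le_measure; rewrite ?inE.
- by apply: measurableI => //; exact: measurable_preimage.
- by apply: measurableI => //; exact: measurable_preimage.
move=> w [A'w /=]; rewrite in_itv/= andbT => Zw.
by split => //=; rewrite in_itv/= andbT (lt_le_trans _ Zw)// ltrDl.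
Unshelve. all: by end_near. Qed.

End limit_law.

Lemma eq_law_rays d d' (T : measurableType d) (T' : measurableType d')
    (R : realType) (m : {measure set T -> \bar R})
    (m' : {measure set T' -> \bar R}) (f : T -> R) (g : T' -> R) :
  (m setT < +oo)%E -> measurable_fun setT f -> measurable_fun setT g ->
  (forall a, m (f @^-1` `]a, +oo[) = m' (g @^-1` `]a, +oo[)) ->
  forall B, measurable B -> m (f @^-1` B) = m' (g @^-1` B).
Proof.
move=> finm mf mg fg B mB.
pose M := image_measure m mf; pose M' := image_measure m' mg.
have mG : @measurable _ R = <<s (@RGenOInfty.G R) >>.
  exact: RGenOInfty.measurableE.
rewrite -[LHS]/(M B) -[RHS]/(M' B).
apply: (@measure_unique _ R R (@RGenOInfty.G R)
  (fun n => `](- n%:R)%R, +oo[%classic) mG) => //.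
- move=> _ _ [x ->] [y ->]; exists (Num.max x y).
  by apply/seteqP; split => z /=; rewrite !in_itv/= !andbT gt_max => /andP.
- by move=> n; exists (- n%:R).
- rewrite -subTset => x _; exists (Num.truncn (- x)).+1 => //=.
  by rewrite in_itv/= andbT ltrNl truncnS_gt.
- by move=> _ [x ->]; exact: fg.
- move=> n; apply: (@le_lt_trans _ _ (m setT)) => //.
  have mS : measurable (f @^-1` `](- n%:R)%R, +oo[).
    rewrite -[X in measurable X]setTI; apply: (mf measurableT).
    exact: measurable_itv.
  rewrite -[leLHS]/(m (f @^-1` `](- n%:R)%R, +oo[)).
  by apply: le_measure; rewrite ?inE.
Qed.

Lemma limit_law d d' (T : measurableType d) (T' : measurableType d')
    (R : realType) (m : {measure set T -> \bar R})
    (m' : {measure set T' -> \bar R}) (A : set T) (A' : set T')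
    (Y_ : nat -> T -> R) (Y : T -> R) (Z_ : nat -> T' -> R) (Z : T' -> R) :
  measurable A -> measurable A' -> (m A < +oo)%E -> (m' A' < +oo)%E ->
  (forall n, measurable_fun setT (Y_ n)) -> measurable_fun setT Y ->
  (forall n, measurable_fun setT (Z_ n)) -> measurable_fun setT Z ->
  (forall w, A w -> Y_ ^~ w @ \oo --> Y w) ->
  (forall w, A' w -> Z_ ^~ w @ \oo --> Z w) ->
  (forall n B, measurable B ->
     m (A `&` Y_ n @^-1` B) = m' (A' `&` Z_ n @^-1` B)) ->
  forall B, measurable B -> m (A `&` Y @^-1` B) = m' (A' `&` Z @^-1` B).
Proof.
move=> mA mA' finA finA' mY_ mY mZ_ mZ cvgY cvgZ YZ B mB.
rewrite setIC [in RHS]setIC.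
rewrite -[LHS]/(mrestr m mA _) -[RHS]/(mrestr m' mA' _).
apply: eq_law_rays => // [|a]; first by rewrite -[ltLHS]/(m (setT `&` A)) setTI.
rewrite -[LHS]/(m (_ `&` A)) -[RHS]/(m' (_ `&` A')) setIC [in RHS]setIC.
apply/eqP; rewrite eq_le; apply/andP; split.
  by apply: (limit_law_lt mA mA' finA' mY_ mY mZ_ mZ) => // n b; exact: YZ.
by apply: (limit_law_lt mA' mA finA mZ_ mZ mY_ mY) => // n b; exact/esym/YZ.
Qed.

(** Under the restriction of P to A, the pair (f, g) and the product measure
    scaled by P A agree on boxes, a class closed under intersection that
    generates the product sigma-algebra. *)
Lemma product_law d d1 d2 (T : measurableType d) (T1 : measurableType d1)
    (T2 : measurableType d2) (R : realType) (P : probability T R)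
    (m1 : probability T1 R) (m2 : probability T2 R) (A : set T)
    (f : T -> T1) (g : T -> T2) :
  measurable A -> measurable_fun setT f -> measurable_fun setT g ->
  (forall B C, measurable B -> measurable C ->
    P (A `&` (f @^-1` B `&` g @^-1` C)) = (P A * (m1 B * m2 C))%E) ->
  forall E, measurable E ->
    P (A `&` [set w | E (f w, g w)]) = (P A * (m1 \x m2) E)%E.
Proof.
move=> mA mf mg fg E mE.
have mfg : measurable_fun setT (fun w => (f w, g w)) by exact: measurable_fun_pair.
have PA0 : 0 <= fine (P A) by rewrite fine_ge0.
pose M := image_measure (mrestr P mA) mfg.
pose N := mscale (NngNum PA0) (m1 \x m2)%E.
have PAE : P A = (fine (P A))%:E by rewrite fineK// fin_num_measure.
have : M E = N E.
  apply: (measure_unique [set B `*` C | B in measurable & C in measurable]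
    (fun n => setT)) => //.
  - exact: measurable_prod_measurableType.
  - move=> _ _ [B1 mB1 [C1 mC1 <-]] [B2 mB2 [C2 mC2 <-]].
    exists (B1 `&` B2); first exact: measurableI.
    by exists (C1 `&` C2); [exact: measurableI|rewrite setXI].
  - by move=> n; exists setT => //; exists setT => //; rewrite setXTT.
  - by rewrite -subTset => x _; exists 0%N.
  - move=> _ [B mB [C mC <-]].
    rewrite /M /N /image_measure/= /pushforward /mrestr /mscale/=.
    by rewrite product_measure1E// -PAE -fg// setIC.
  - move=> n; rewrite /M /image_measure/= /pushforward /mrestr preimage_setT setTI.
    by rewrite (le_lt_trans (probability_le1 _ _))// ltry.
rewrite /M /N /image_measure/= /pushforward /mrestr /mscale/= -PAE => <-.
by rewrite setIC.
Qed.

(** Both sides are finite measures in A that agree on a generating class closed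
    under intersection. *)
Lemma generated_independent d (T : measurableType d) (R : realType)
    (P : probability T R) (G : set_system T) (V : set T) (k : \bar R) :
  setI_closed G -> G setT -> G `<=` measurable -> measurable V ->
  (forall A, G A -> P (A `&` V) = (P A * k)%E) ->
  forall A, <<s G >> A -> P (A `&` V) = (P A * k)%E.
Proof.
move=> GI GT Gm mV PV A sGA.
have kE : k = P V by rewrite -(setTI V) PV// probability_setT mul1e.
have [c c0 PVE] : exists2 c : R, 0 <= c & P V = c%:E.
  by exists (fine (P V)); rewrite ?fine_ge0// fineK// fin_num_measure.
have : mrestr P mV A = mscale (NngNum c0) P A.
  apply: (g_sigma_algebra_measure_unique G Gm (fun _ : nat => setT)) => //.
  - by rewrite -subTset => x _; exists 0%N.
  - by move=> B GB; rewrite [LHS]PV// [RHS]muleC kE PVE.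
  - by move=> n; rewrite [ltLHS](_ : _ = c%:E) ?ltry//= /mrestr setTI.
by rewrite kE PVE muleC.
Qed.

(** Independence of the event A and of Y_n is an equality of laws, between Y_n
    under the restriction of P to A and Z_n under P' scaled by P A; equalities
    of laws pass to the limit. *)
Lemma limit_independent d d' (T : measurableType d) (T' : measurableType d')
    (R : realType) (P : probability T R) (P' : probability T' R) (A : set T)
    (Y_ : nat -> T -> R) (Y : T -> R) (Z_ : nat -> T' -> R) (Z : T' -> R) :
  measurable A ->
  (forall n, measurable_fun setT (Y_ n)) -> measurable_fun setT Y ->
  (forall n, measurable_fun setT (Z_ n)) -> measurable_fun setT Z ->
  (forall w, A w -> Y_ ^~ w @ \oo --> Y w) ->
  (forall w, Z_ ^~ w @ \oo --> Z w) ->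
  (forall n B, measurable B ->
     P (A `&` Y_ n @^-1` B) = (P A * P' (Z_ n @^-1` B))%E) ->
  forall B, measurable B -> P (A `&` Y @^-1` B) = (P A * P' (Z @^-1` B))%E.
Proof.
move=> mA mY_ mY mZ_ mZ cvgY cvgZ YZ B mB.
have [c c0 PAE] : exists2 c : R, 0 <= c & P A = c%:E.
  by exists (fine (P A)); rewrite ?fine_ge0// fineK// fin_num_measure.
rewrite -[X in P' X]setTI PAE.
rewrite -[RHS]/(mscale (NngNum c0) P' (setT `&` Z @^-1` B)).
apply: (limit_law (Y_ := Y_) (Z_ := Z_)) => //.
- by rewrite [ltLHS]PAE ltry.
- by rewrite [ltLHS](_ : _ = (c%:E * P' setT)%E)// probability_setT mule1 ltry.
- by move=> n C mC; rewrite [LHS]YZ// PAE setTI.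
Qed.

(** * Splitting a uniform variable *)

Section uniform.
Context {R : realType}.
Implicit Types (u x : R) (n m : nat) (e : bool) (A B C : set R).
Local Notation mu := (@lebesgue_measure R).

Definition unif : set (measurableTypeR R) -> \bar R :=
  mrestr mu (measurable_itv (`[0%R, 1%R[ : interval R)).

HB.instance Definition _ := Measure.on unif.

Let unif_setT : unif setT = 1%E.
Proof.
by rewrite /unif /mrestr setTI lebesgue_measure_itv/= lte_fin ltr01 sube0.
Qed.

HB.instance Definition _ := Measure_isProbability.Build _ _ _ unif unif_setT.

Lemma unif_itv A : unif (`[0, 1[ `&` A) = unif A.
Proof. by rewrite /unif /mrestr setIAC setIid setIC. Qed.

Let unif_lty A : measurable A -> (unif A < +oo)%E.
Proof. by move=> mA; rewrite (le_lt_trans (probability_le1 _ _))// ltry. Qed.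

(** The first binary digit of u, and the number formed by the other digits. *)
Definition bit u : bool := 1 / 2 <= u.

Definition dbl u : R := 2 * u - (bit u)%:R.

Lemma measurable_bit : measurable_fun setT bit.
Proof. exact: measurable_fun_ler. Qed.

Lemma measurable_bit_R : measurable_fun setT (fun u => (bit u)%:R : R).
Proof.
rewrite (_ : (fun u => _) = \1_[set u | bit u]).
  apply: measurable_indic.
  by rewrite -[X in measurable X]setTI; exact: (measurable_bit measurableT).
apply/funext => u; rewrite indicE; congr (_%:R); apply: congr1.
by apply/idP/idP; rewrite inE.
Qed.

Lemma measurable_dbl : measurable_fun setT dbl.
Proof.
by apply: measurable_funB; [exact: measurable_funM|exact: measurable_bit_R].
Qed.

(** Where the first digit is e, [dbl] is the affine map u |-> 2 u - e, under
    which the Lebesgue measure is divided by 2. Hence the number formed by the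
    other digits is uniform, whatever the first one. *)
Lemma unif_bit e A : measurable A ->
  (2%:E * unif ([set u | bit u = e] `&` dbl @^-1` A) = unif A)%E.
Proof.
move=> mA; rewrite /unif /mrestr.
have mA' : measurable (A `&` `[0, 1[) by exact: measurableI.
rewrite -[RHS](@lebesgue_affine _ 2 (- e%:R) _ _ mA')//.
congr (_ * mu _)%E; apply/seteqP; split => u /=; rewrite /affine /dbl /bit.
  rewrite !in_itv/= => -[[<- Au] /andP[u0 u1]]; split => //.
  by case: (lerP (1 / 2) u) => /= h; apply/andP; split; lra.
rewrite !in_itv/= => -[Au /andP[u0 u1]].
have b : (1 / 2 <= u) = e.
  by case: e u0 u1 {Au} => /= ? ?; [lra|apply/negbTE; rewrite -ltNge; lra].
rewrite b; split => //; apply/andP.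
by case: e b {Au} u0 u1 => /= ? ? ?; split; lra.
Qed.

Lemma measurable_preimage_dbl A : measurable A -> measurable (dbl @^-1` A).
Proof. exact: measurable_preimage measurable_dbl. Qed.

Lemma measurable_preimage_bit e : measurable [set u : R | bit u = e].
Proof.
have := measurable_bit measurableT (Y := [set e]).
by rewrite setTI; apply.
Qed.

(** Real values let ring and field identities apply. *)
Let pr A : R := fine (unif A).

Let prE A : measurable A -> unif A = (pr A)%:E.
Proof. by move=> mA; rewrite fineK// fin_num_measure. Qed.

Let pr_bit e A : measurable A ->
  pr ([set u | bit u = e] `&` dbl @^-1` A) = pr A / 2.
Proof.
move=> mA; have mA' := measurable_preimage_dbl mA.
have mB : measurable ([set u | bit u = e] `&` dbl @^-1` A).
  by apply: measurableI => //; exact: measurable_preimage_bit.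
have := unif_bit e mA; rewrite !prE// => -[<-].
by rewrite mulrAC divff ?mul1r// pnatr_eq0.
Qed.

Let pr_split A : measurable A ->
  pr A = pr ([set u | bit u = true] `&` A) + pr ([set u | bit u = false] `&` A).
Proof.
move=> mA; have mb e := measurableI _ _ (measurable_preimage_bit e) mA.
have AE : A = ([set u | bit u = true] `&` A) `|` ([set u | bit u = false] `&` A).
  rewrite -setIUl [X in X `&` _](_ : _ = setT) ?setTI//.
  by apply/seteqP; split => u //= _; case: (bit u); [left|right].
rewrite {1}AE {1}/pr measureU; [|exact: mb|exact: mb|].
  by rewrite fineD//; apply: fin_num_measure; exact: mb.
by apply/seteqP; split => u //= -[[-> _] []].
Qed.

Let pr_dbl A : measurable A -> pr (dbl @^-1` A) = pr A.
Proof.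
move=> mA; rewrite pr_split ?pr_bit//; last exact: measurable_preimage_dbl.
by rewrite -splitr.
Qed.

(** The number whose first n binary digits are those of ranks 0, 2, 4, ... of u. *)
Fixpoint evens n u : R :=
  if n is n'.+1 then ((bit u)%:R + evens n' (dbl (dbl u))) / 2 else 0.

(** The truncation of u after n binary digits. *)
Fixpoint digits n u : R :=
  if n is n'.+1 then ((bit u)%:R + digits n' (dbl u)) / 2 else 0.

Lemma measurable_evens n : measurable_fun setT (evens n).
Proof.
elim: n => [|n ih]//=; apply: measurable_funM => //.
apply: measurable_funD; first exact: measurable_bit_R.
apply: measurableT_comp => //.
by apply: measurableT_comp; exact: measurable_dbl.
Qed.

Lemma measurable_digits n : measurable_fun setT (digits n).
Proof.
elim: n => [|n ih]//=; apply: measurable_funM => //.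
apply: measurable_funD; first exact: measurable_bit_R.
by apply: measurableT_comp => //; exact: measurable_dbl.
Qed.

(** The numbers x that the digit e, put in front of their binary expansion,
    sends into B. *)
Let half e B : set R := (fun x => (e%:R + x) / 2) @^-1` B.

Let measurable_half e B : measurable B -> measurable (half e B).
Proof.
move=> mB; apply: measurable_preimage => //; apply: measurable_funM => //.
exact: measurable_funD.
Qed.

Let pr_evensS n B : measurable B -> pr (evens n.+1 @^-1` B) =
  (pr (evens n @^-1` half true B) + pr (evens n @^-1` half false B)) / 2.
Proof.
move=> mB; rewrite pr_split; last first.
  by apply: measurable_preimage => //; exact: measurable_evens.
have E e : [set u | bit u = e] `&` evens n.+1 @^-1` B =
    [set u | bit u = e] `&` dbl @^-1` (dbl @^-1` (evens n @^-1` half e B)).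
  by apply/seteqP; split => u [/= be]; rewrite /half/= be.
have me e : measurable (evens n @^-1` half e B).
  by apply: measurable_preimage; [exact: measurable_evens|exact: measurable_half].
by rewrite !E !pr_bit ?pr_dbl// ?mulrDl//; exact: measurable_preimage_dbl.
Qed.

Let pr_digitsS n B : measurable B -> pr (digits n.+1 @^-1` B) =
  (pr (digits n @^-1` half true B) + pr (digits n @^-1` half false B)) / 2.
Proof.
move=> mB; rewrite pr_split; last first.
  by apply: measurable_preimage => //; exact: measurable_digits.
have E e : [set u | bit u = e] `&` digits n.+1 @^-1` B =
    [set u | bit u = e] `&` dbl @^-1` (digits n @^-1` half e B).
  by apply/seteqP; split => u [/= be]; rewrite /half/= be.
have me e : measurable (digits n @^-1` half e B).
  by apply: measurable_preimage; [exact: measurable_digits|exact: measurable_half].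
by rewrite !E !pr_bit ?mulrDl.
Qed.

Let pr_evens_digits n B : measurable B ->
  pr (evens n @^-1` B) = pr (digits n @^-1` B).
Proof.
elim: n B => [//|n ih] B mB.
by rewrite pr_evensS// pr_digitsS// !ih//; exact: measurable_half.
Qed.

(** Removing one binary digit of u exchanges the digits of even rank and
    those of odd rank: this is the induction step. *)
Let pr_evens_odds n m B C : measurable B -> measurable C ->
  pr (evens n @^-1` B `&` dbl @^-1` (evens m @^-1` C)) =
  pr (evens n @^-1` B) * pr (evens m @^-1` C).
Proof.
have [k nmk] := ubnP (n + m); elim: k n m nmk B C => // k ih n m nmk B C mB mC.
have mE j D : measurable D -> measurable (evens j @^-1` D).
  by move=> mD; apply: measurable_preimage => //; exact: measurable_evens.
have mdE j D : measurable D -> measurable (dbl @^-1` (evens j @^-1` D)).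
  by move=> mD; apply: measurable_preimage_dbl; exact: mE.
case: n nmk => [|n] nmk.
  have [B0|B0] := pselect (B 0).
    rewrite (_ : evens 0 @^-1` B = setT); last by apply/seteqP; split.
    by rewrite setTI pr_dbl; [rewrite /pr probability_setT mul1r|exact: mE].
  rewrite (_ : evens 0 @^-1` B = set0); last by apply/seteqP; split.
  by rewrite set0I /pr measure0 mul0r.
rewrite pr_split; last by apply: measurableI; [exact: mE|exact: mdE].
have E e : [set u | bit u = e] `&` (evens n.+1 @^-1` B `&` dbl @^-1` (evens m @^-1` C))
  = [set u | bit u = e] `&` dbl @^-1`
      (evens m @^-1` C `&` dbl @^-1` (evens n @^-1` half e B)).
  by apply/seteqP; split => u [/= be]; rewrite /half/= be => -[].
have mh e : measurable (half e B) by exact: measurable_half.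
rewrite !E !pr_bit; last 2 first.
- by apply: measurableI; [exact: mE|exact: mdE].
- by apply: measurableI; [exact: mE|exact: mdE].
by rewrite !ih// 1?addnC// pr_evensS//; ring.
Qed.

Let unif_pre (f : R -> R) B : measurable_fun setT f -> measurable B ->
  unif (f @^-1` B) = (pr (f @^-1` B))%:E.
Proof. by move=> mf mB; apply: prE; exact: measurable_preimage. Qed.

Lemma evens_itv n u : 0 <= evens n u <= 1.
Proof.
elim: n u => [|n ih] u /=; first by rewrite lexx ler01.
have /andP[] := ih (dbl (dbl u)).
by case: (bit u) => /= ? ?; apply/andP; split; lra.
Qed.

Lemma evens_nondecreasing u : nondecreasing_seq (evens ^~ u).
Proof.
apply/nondecreasing_seqP => n; elim: n u => [|n ih] u.
  by have /andP[] := evens_itv 1 u.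
by rewrite /= ler_pM2r ?invr_gt0// lerD2l; exact: ih.
Qed.

Definition even_part u : R := limn (evens ^~ u).

Lemma cvg_evens u : evens ^~ u @ \oo --> even_part u.
Proof.
apply: nondecreasing_is_cvgn; first exact: evens_nondecreasing.
by exists 1 => _ [n _ <-]; have /andP[] := evens_itv n u.
Qed.

Lemma measurable_even_part : measurable_fun setT even_part.
Proof.
apply: (measurable_fun_cvg measurable_evens) => u _; exact: cvg_evens.
Qed.

Lemma digits_approx n u : 0 <= u < 1 -> `|u - digits n u| <= (1 / 2) ^+ n.
Proof.
elim: n u => [|n ih] u /andP[u0 u1] /=.
  by rewrite subr0 expr0 ger0_norm// ltW.
have -> : u - ((bit u)%:R + digits n (dbl u)) / 2 = (dbl u - digits n (dbl u)) / 2.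
  by rewrite /dbl; lra.
rewrite normrM exprSr ler_pM//; last by rewrite ger0_norm// div1r.
by apply: ih; rewrite /dbl /bit; case: (lerP (1 / 2) u) => /= h; apply/andP; split; lra.
Qed.

Lemma cvg_digits u : 0 <= u < 1 -> digits ^~ u @ \oo --> u.
Proof.
move=> u01; apply/cvgrPdist_le => e e0; near=> n.
apply: (le_trans (digits_approx n u01)).
near: n; have : (fun n => (1 / 2 : R) ^+ n) @ \oo --> 0.
  by apply: cvg_expr; rewrite ger0_norm//; lra.
move=> /cvgrPdist_le /(_ _ e0); apply: filterS => n.
by rewrite sub0r normrN ger0_norm.
Unshelve. all: by end_near. Qed.

(** The truncations of both sides have the same law, since n digits of u have
    the same joint law whether consecutive or not. *)
Lemma even_part_law B : measurable B -> unif (even_part @^-1` B) = unif B.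
Proof.
move=> mB; rewrite -(setTI (even_part @^-1` B)).
rewrite (@limit_law _ _ _ _ R unif unif setT `[0, 1[ evens even_part digits id)//.
- exact: unif_itv.
- exact: unif_lty.
- exact: unif_lty.
- exact: measurable_evens.
- exact: measurable_even_part.
- exact: measurable_digits.
- by move=> u _; exact: cvg_evens.
- by move=> u; rewrite /= in_itv/=; exact: cvg_digits.
- move=> n C mC; rewrite setTI.
  rewrite [RHS]unif_itv.
  rewrite [LHS](unif_pre (measurable_evens n) mC) pr_evens_digits//.
  by rewrite -(unif_pre (measurable_digits n) mC).
Qed.

(** The two maps are limits of maps that depend on finitely many digits, for
    which independence is an identity between finite averages
    ([pr_evens_odds]); the limit is taken in one map, then in the other. *)
Lemma unif_split B C : measurable B -> measurable C ->
  unif (even_part @^-1` B `&` (even_part \o dbl) @^-1` C) = (unif B * unif C)%E.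
Proof.
move=> mB mC.
have mp := measurable_even_part.
have mq : measurable_fun setT (even_part \o dbl).
  by apply: measurableT_comp => //; exact: measurable_dbl.
have mQ : measurable ((even_part \o dbl) @^-1` C) by exact: measurable_preimage.
have q_law : unif ((even_part \o dbl) @^-1` C) = unif C.
  transitivity (pr (dbl @^-1` (even_part @^-1` C)))%:E; first exact: unif_pre.
  rewrite pr_dbl; last exact: measurable_preimage.
  by rewrite -even_part_law//; exact/esym/unif_pre.
rewrite setIC -[in RHS](even_part_law mB) muleC -q_law.
apply: (@limit_independent _ _ _ _ R unif unif _ evens even_part evens even_part) => //.
- exact: measurable_evens.
- exact: measurable_evens.
- by move=> u _; exact: cvg_evens.
- exact: cvg_evens.
move=> n D mD; rewrite setIC muleC.
have mE : measurable (evens n @^-1` D) by apply: measurable_preimage => //; exact: measurable_evens.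
rewrite [X in (_ * X)%E](etrans q_law (esym (even_part_law mC))).
apply: (@limit_independent _ _ _ _ R unif unif _
  (fun n => evens n \o dbl) (even_part \o dbl) evens even_part) => //.
- move=> k; apply: measurableT_comp; first exact: measurable_evens.
  exact: measurable_dbl.
- exact: measurable_evens.
- by move=> u _; exact: cvg_evens.
- exact: cvg_evens.
move=> k F mF.
have mX : measurable (evens n @^-1` D `&` (evens k \o dbl) @^-1` F).
  apply: measurableI => //; apply: measurable_preimage => //; apply: measurableT_comp.
    exact: measurable_evens.
  exact: measurable_dbl.
rewrite [LHS](prE mX) [X in (X * _)%E](unif_pre (measurable_evens n) mD).
rewrite [X in (_ * X)%E](unif_pre (measurable_evens k) mF) -EFinM.
by congr (_%:E); exact: pr_evens_odds.
Qed.

End uniform.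

(** * Sampling from the Gaussian measure *)

Section quantile.
Context {R : realType}.
Implicit Types (u x : R) (B : set R).
Local Notation gauss := (@normal_prob R 0 1).
Local Notation unif := (@unif R).

Definition gauss_cdf x : R := fine (gauss `]-oo, x]).

Lemma gauss_cdfE x : gauss `]-oo, x] = (gauss_cdf x)%:E.
Proof. by rewrite fineK// fin_num_measure. Qed.

Lemma gauss_cdf_nondecreasing : {homo gauss_cdf : x y / x <= y}.
Proof.
move=> x y xy; rewrite fine_le ?fin_num_measure//; apply: le_measure; rewrite ?inE//.
exact: subset_itvl.
Qed.

Let idR : measurableTypeR R -> R := idfun.

#[local] HB.instance Definition _ :=
  @isMeasurableFun.Build _ _ _ _ idR (@measurable_id _ _ setT).

Lemma gauss_cdf_right_continuous : right_continuous gauss_cdf.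
Proof.
move=> a; apply: fine_cvg; rewrite fineK ?fin_num_measure//.
exact: (@cdf_right_continuous _ _ _ gauss idR a).
Qed.

Lemma cvg_gauss_cdfNy : gauss_cdf @ -oo --> (0:R).
Proof. by apply/fine_cvg; exact: (@cvg_cdfNy0 _ _ _ gauss idR). Qed.

Lemma cvg_gauss_cdfy : gauss_cdf @ +oo --> (1:R).
Proof. by apply/fine_cvg; exact: (@cvg_cdfy1 _ _ _ gauss idR). Qed.

(** The value 0 outside ]0, 1[, where the infimum is meaningless, only concerns
    a set of measure 0. *)
Definition quantile u : R :=
  if 0 < u < 1 then inf [set x | u <= gauss_cdf x] else 0.

(** The infimum is attained since the cumulative distribution function is
    right-continuous. *)
Lemma quantile_le u x : 0 < u < 1 -> (quantile u <= x) = (u <= gauss_cdf x).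
Proof.
move=> u01; rewrite /quantile u01; move/andP: u01 => [u0 u1].
set E := [set x | _].
have lbE : has_lbound E.
  have [b [_ Hb]] := cvgr_lt _ cvg_gauss_cdfNy _ u0.
  exists (b - 1) => y /= uy; rewrite leNgt; apply/negP => yb.
  have yb' : y < b by apply: (lt_trans yb); rewrite ltrBlDr ltrDl.
  have /= := Hb _ yb'; rewrite ltNge => /negP; exact.
have neE : E !=set0.
  have [b [_ Hb]] := cvgr_gt _ cvg_gauss_cdfy _ u1.
  by exists (b + 1); rewrite /E/= ltW//; apply: Hb; rewrite ltrDl.
apply/idP/idP => [qx|ux]; last by apply: ge_inf.
rewrite leNgt; apply/negP => xu.
have /cvgr_lt/(_ _ xu) := @gauss_cdf_right_continuous x.
move=> -[e /= e0 He].
have xe : x < x + e / 2 by rewrite ltrDl divr_gt0.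
have /(inf_lt neE) [y /= uy ye] : inf E < x + e / 2.
  exact: le_lt_trans qx _.
have : gauss_cdf (x + e / 2) < u.
  apply: He => //=; rewrite opprD addrA subrr sub0r normrN ger0_norm; last first.
    by rewrite divr_ge0// ltW.
  by rewrite ltr_pdivrMr// ltr_pMr// ltr1n.
by rewrite ltNge (le_trans uy)// gauss_cdf_nondecreasing// ltW.
Qed.

Lemma quantile_ray a : quantile @^-1` `]a, +oo[ =
  (`]0, 1[ `&` `]gauss_cdf a, +oo[) `|` (~` `]0, 1[ `&` [set _ | a < 0]).
Proof.
apply/seteqP; split => u /=; rewrite !in_itv/= !andbT.
  case: (boolP (0 < u < 1)) => u01.
    by rewrite ltNge quantile_le// -ltNge; left.
  by rewrite /quantile (negbTE u01) => a0; right; split => //; apply/negP.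
move=> [[u01 au]|[/negP u01 a0]].
  by rewrite ltNge quantile_le// -ltNge.
by rewrite /quantile (negbTE u01).
Qed.

Let measurable_cst_set (b : bool) : measurable [set _ : R | b].
Proof.
case: b; first by rewrite (_ : [set _ | _] = setT)//; apply/seteqP; split.
by rewrite (_ : [set _ | _] = set0)//; apply/seteqP; split.
Qed.

Lemma measurable_quantile : measurable_fun setT quantile.
Proof.
apply: (measurability _ (RGenOInfty.measurableE R)) => _ [_ [a ->] <-].
rewrite setTI quantile_ray; apply: measurableU; apply: measurableI => //.
exact: measurableC.
Qed.

(** Inverse transform sampling. *)
Lemma quantile_law B : measurable B -> unif (quantile @^-1` B) = gauss B.
Proof.
move=> mB; rewrite -[in RHS](preimage_id B).
apply: eq_law_rays => // [||a].
- by rewrite [ltLHS](@probability_setT _ _ _ unif) ltry.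
- exact: measurable_quantile.
rewrite preimage_id quantile_ray.
have F0 : 0 <= gauss_cdf a by rewrite fine_ge0.
have F1 : gauss_cdf a <= 1.
  by rewrite -lee_fin -gauss_cdfE probability_le1.
have gaussE : gauss `]a, +oo[ = (1 - gauss_cdf a)%:E.
  rewrite -setCitvl [LHS]probability_setC// EFinB.
  exact: (congr1 (fun z => 1 - z)%E (gauss_cdfE a)).
rewrite [RHS]gaussE.
rewrite /= measureU0//.
- have E : `]0, 1[ `&` `]gauss_cdf a, +oo[ `&` `[0, 1[ =
      `]gauss_cdf a, 1[%classic.
    apply/seteqP; split => u /=; rewrite !in_itv/= !andbT.
      by move=> [[/andP[? ?] ?] _]; apply/andP.
    move=> /andP[au u1]; have u0 := le_lt_trans F0 au.
    by rewrite u0 (ltW u0).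
  transitivity (lebesgue_measure `]gauss_cdf a, 1[%classic); first by rewrite -E.
  rewrite lebesgue_measure_itv/= lte_fin; case: ltP => // F1'.
  by rewrite (@le_anti _ _ (gauss_cdf a) 1) ?F1// subrr.
- exact: measurableI.
- apply: measurableI; first exact: measurableC.
  exact: measurable_cst_set.
apply/eqP; rewrite eq_le measure_ge0 andbT -[leRHS](@lebesgue_measure_set1 R 0).
rewrite -[leLHS]/(lebesgue_measure (_ `&` `[0, 1[)).
apply: le_measure; rewrite ?inE//.
  apply: measurableI => //; apply: measurableI; first exact: measurableC.
  exact: measurable_cst_set.
move=> u [[/= /negP]]; rewrite !in_itv/= => u01 _ /andP[u0 u1].
by move: u01; rewrite u1 andbT -leNgt => u0'; apply/eqP; rewrite eq_le u0' u0.
Qed.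

End quantile.

(** * The two halves of a seed *)

Section halving.
Context {R : realType}.
Local Notation gauss := (@normal_prob R 0 1).
Local Notation unif := (@unif R).
Local Notation S := (measurableTypeR R * measurableTypeR R)%type.
Implicit Types (s : S) (B C : set S).

(** The scaling factor of a Wiener process when time is halved. *)
Definition rho : R := (Num.sqrt 2)^-1.

Lemma rho_gt0 : 0 < rho.
Proof. by rewrite invr_gt0 sqrtr_gt0. Qed.

Lemma rho_sqr : rho ^+ 2 = 1 / 2.
Proof. by rewrite exprVn sqr_sqrtr// div1r. Qed.

(** The law of a seed: a standard normal increment and an independent uniform
    reserve of randomness. *)
Definition seed : probability S R := (gauss \x unif)%E.

(** A standard normal variable drawn from the even digits of the reserve; the
    odd digits are shared between the reserves of the two halves. *)
Definition fresh s : R := quantile (even_part s.2).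
Definition left_half s : S :=
  (rho * s.1 + rho * fresh s, even_part (even_part (dbl s.2))).
Definition right_half s : S :=
  (rho * s.1 - rho * fresh s, even_part (dbl (even_part (dbl s.2)))).

Lemma halves_sum s : (left_half s).1 + (right_half s).1 = rho * 2 * s.1.
Proof. by rewrite /left_half/right_half/=; ring. Qed.

Let mq : measurable_fun setT (@even_part R \o dbl).
Proof.
by apply: measurableT_comp; [exact: measurable_even_part|exact: measurable_dbl].
Qed.

Lemma measurable_fresh : measurable_fun setT fresh.
Proof.
apply: measurableT_comp; first exact: measurable_quantile.
by apply: measurableT_comp => //; exact: measurable_even_part.
Qed.

Let mq2 : measurable_fun setT (fun s : S => even_part (dbl s.2)).
Proof. by apply: (measurableT_comp mq). Qed.

Lemma measurable_left_half : measurable_fun setT left_half.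
Proof.
apply: measurable_fun_pair => /=.
  apply: measurable_funD; first exact: measurable_funM.
  by apply: measurable_funM => //; exact: measurable_fresh.
by apply: measurableT_comp mq2; exact: measurable_even_part.
Qed.

Lemma measurable_right_half : measurable_fun setT right_half.
Proof.
apply: measurable_fun_pair => /=.
  apply: measurable_funB; first exact: measurable_funM.
  by apply: measurable_funM => //; exact: measurable_fresh.
by apply: (measurableT_comp mq) => //; exact: mq2.
Qed.

Let seed_box (B1 B2 C : set R) : measurable B1 -> measurable B2 -> measurable C ->
  seed ((fun s => even_part (dbl s.2)) @^-1` C `&`
        ((fst : S -> R) @^-1` B1 `&` fresh @^-1` B2)) =
  (unif C * (gauss B1 * gauss B2))%E.
Proof.
move=> mB1 mB2 mC.
have mz : measurable (@quantile R @^-1` B2).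
  by rewrite -[X in measurable X]setTI; exact: measurable_quantile.
transitivity (seed (B1 `*` (@even_part R @^-1` (quantile @^-1` B2) `&`
   (even_part \o dbl) @^-1` C))).
  congr (seed _); apply/seteqP; split => s /=; first by move=> [? [? ?]].
  by move=> [? [? ?]].
rewrite [LHS]product_measure1E//; last first.
  apply: measurableI; rewrite -[X in measurable X]setTI.
    exact: measurable_even_part.
  exact: mq.
by rewrite [X in (_ * X)%E]unif_split// quantile_law// muleA muleC.
Qed.

Let seed_q (C : set R) : measurable C ->
  seed ((fun s => even_part (dbl s.2)) @^-1` C) = unif C.
Proof.
move=> mC; have := seed_box measurableT measurableT mC.
rewrite !preimage_setT !setIT => ->.
by rewrite [gauss setT]probability_setT !mule1.
Qed.

(** The increments come from the rotation by pi / 4 of the pair formed by the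
    increment of s and by [fresh s]; the reserves come from the odd digits of
    s.2, of which this pair is independent. *)
Let seed_halves_box (D1 D2 C1 C2 : set R) :
  measurable D1 -> measurable D2 -> measurable C1 -> measurable C2 ->
  seed ((fst \o left_half) @^-1` D1 `&` (fst \o right_half) @^-1` D2 `&`
    ((snd \o left_half) @^-1` C1 `&` (snd \o right_half) @^-1` C2)) =
  (gauss D1 * gauss D2 * (unif C1 * unif C2))%E.
Proof.
move=> mD1 mD2 mC1 mC2.
pose C := @even_part R @^-1` C1 `&` (even_part \o dbl) @^-1` C2.
have mC : measurable C.
  apply: measurableI; rewrite -[X in measurable X]setTI.
    exact: measurable_even_part.
  exact: mq.
pose E := [set p : R * R | D1 (rho * p.1 + rho * p.2) /\ D2 (rho * p.1 - rho * p.2)].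
have mE : measurable E.
  apply: measurableI; rewrite -[X in measurable X]setTI.
    have : measurable_fun setT (fun p : R * R => rho * p.1 + rho * p.2).
      by apply: measurable_funD; exact: measurable_funM.
    exact.
  have : measurable_fun setT (fun p : R * R => rho * p.1 - rho * p.2).
    by apply: measurable_funB; exact: measurable_funM.
  exact.
rewrite setIC.
transitivity (seed ((fun s => even_part (dbl s.2)) @^-1` C `&`
  [set s : S | E (s.1, fresh s)])) => //.
rewrite (@product_law _ _ _ _ _ _ R seed gauss gauss)//.
- rewrite [X in (X * _)%E]seed_q// [X in (X * _)%E]unif_split// muleC.
  rewrite [X in (X * _)%E]gauss_rotation ?rho_gt0//.
  by rewrite rho_sqr -splitr.
- exact: measurable_preimage.
- exact: measurable_fresh.
- by move=> B1 B2 mB1 mB2; rewrite seed_box//; congr (_ * _)%E; exact/esym/seed_q.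
Qed.

(** From boxes in the four coordinates, the product formula extends to one half
    at a time. *)
Lemma seed_halves B C : measurable B -> measurable C ->
  seed (left_half @^-1` B `&` right_half @^-1` C) = (seed B * seed C)%E.
Proof.
move=> mB mC.
have ml1 : measurable_fun setT (fst \o left_half).
  by apply: measurableT_comp => //; exact: measurable_left_half.
have ml2 : measurable_fun setT (snd \o left_half).
  by apply: measurableT_comp => //; exact: measurable_left_half.
have mr1 : measurable_fun setT (fst \o right_half).
  by apply: measurableT_comp => //; exact: measurable_right_half.
have mr2 : measurable_fun setT (snd \o right_half).
  by apply: measurableT_comp => //; exact: measurable_right_half.
have right_box (D2 C2 : set R) : measurable D2 -> measurable C2 ->
    seed ((fst \o right_half) @^-1` D2 `&` (snd \o right_half) @^-1` C2) =
    (gauss D2 * unif C2)%E.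
  move=> mD2 mC2; have := seed_halves_box measurableT mD2 measurableT mC2.
  rewrite !preimage_setT !setTI => ->.
  by rewrite [gauss setT]probability_setT [unif setT]probability_setT !mul1e.
have left_law (D2 C2 : set R) : measurable D2 -> measurable C2 ->
    seed ((fst \o right_half) @^-1` D2 `&` (snd \o right_half) @^-1` C2 `&`
      left_half @^-1` B) = (gauss D2 * unif C2 * seed B)%E.
  move=> mD2 mC2.
  transitivity (seed ((fst \o right_half) @^-1` D2 `&` (snd \o right_half) @^-1` C2 `&`
      [set s | B ((fst \o left_half) s, (snd \o left_half) s)])).
    congr (seed (_ `&` _)); apply/seteqP; split => s /=;
    by case: (left_half s).
  rewrite (@product_law _ _ _ _ _ _ R seed gauss unif)//.
  - by rewrite right_box.
  - by apply: measurableI; exact: measurable_preimage.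
  move=> D1 C1 mD1 mC1; rewrite right_box//.
  transitivity (gauss D1 * gauss D2 * (unif C1 * unif C2))%E.
    rewrite -seed_halves_box//; congr (seed _).
    by rewrite [RHS]setIACA setIC.
  by rewrite muleACA [RHS]muleC.
transitivity (seed (left_half @^-1` B `&`
    [set s | C ((fst \o right_half) s, (snd \o right_half) s)])).
  by congr (seed (_ `&` _)); apply/seteqP; split => s /=; case: (right_half s).
have leftE : seed (left_half @^-1` B) = seed B.
  have := left_law _ _ measurableT measurableT.
  rewrite !preimage_setT !setTI => ->.
  by rewrite [gauss setT]probability_setT [unif setT]probability_setT !mul1e.
rewrite (@product_law _ _ _ _ _ _ R seed gauss unif)//.
- by rewrite leftE.
- by apply: measurable_preimage => //; exact: measurable_left_half.
by move=> D2 C2 mD2 mC2; rewrite setIC left_law// leftE muleC.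
Qed.

End halving.

(** * Independence of a variable and of a sigma-algebra *)

Section independence.
Context d (T : measurableType d) (R : realType) (P : probability T R).

Definition independent_law d' (U : measurableType d') (G : set_system T)
    (f : T -> U) (law : set U -> \bar R) : Prop :=
  forall A B, G A -> measurable B -> P (A `&` f @^-1` B) = (P A * law B)%E.

Definition join_sigma d' (U : measurableType d') (G : set_system T) (f : T -> U) :
  set_system T := <<s [set A `&` f @^-1` B | A in G & B in measurable] >>.

Definition subsigma_algebra (G : set_system T) : Prop :=
  sigma_algebra setT G /\ G `<=` measurable.

Lemma subsigmaT G : subsigma_algebra G -> G setT.
Proof. by move=> [[G0 GC _] _]; rewrite -setC0 -setTD; exact: GC. Qed.

Lemma subsigmaE G : subsigma_algebra G -> <<s G >> = G.
Proof. by move=> [sG _]; exact: sigma_algebra_id. Qed.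

Lemma subsigmaI G : subsigma_algebra G -> setI_closed G.
Proof.
move=> /subsigmaE GE A B; rewrite -GE.
exact: (@measurableI _ (g_sigma_algebraType G)).
Qed.

Lemma subsigma_generated G : G `<=` measurable -> subsigma_algebra <<s G >>.
Proof.
move=> Gm; split; first exact: smallest_sigma_algebra.
by apply: smallest_sub => //; exact: sigma_algebra_measurable.
Qed.

Section join.
Context d' (U : measurableType d') (G : set_system T) (f : T -> U).
Hypotheses (sG : subsigma_algebra G) (mf : measurable_fun setT f).

Lemma join_sigma_sub : subsigma_algebra (join_sigma G f).
Proof.
apply: subsigma_generated => _ [A GA [B mB <-]].
apply: measurableI; first by case: sG => _; apply.
by rewrite -[X in measurable X]setTI; exact: mf.
Qed.

Lemma subset_join : G `<=` join_sigma G f.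
Proof.
move=> A GA; apply: sub_gen_smallest; exists A => //; exists setT => //.
by rewrite preimage_setT setIT.
Qed.

Lemma join_preimage B : measurable B -> join_sigma G f (f @^-1` B).
Proof.
move=> mB; apply: sub_gen_smallest; exists setT; first exact: subsigmaT.
by exists B => //; rewrite setTI.
Qed.

Lemma join_sigma_min H : subsigma_algebra H -> G `<=` H ->
  (forall B, measurable B -> H (f @^-1` B)) -> join_sigma G f `<=` H.
Proof.
move=> sH GH fH; apply: smallest_sub; first by case: sH.
by move=> _ [A GA [B mB <-]]; apply: (subsigmaI sH); [exact: GH|exact: fH].
Qed.

(** The sets A `&` f @^-1` B are closed under intersection and generate the
    joined sigma-algebra. *)
Lemma join_independent d2 (V : measurableType d2) (g : T -> V)
    (law : set V -> \bar R) : measurable_fun setT g ->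
  (forall A B C, G A -> measurable B -> measurable C ->
    P (A `&` f @^-1` B `&` g @^-1` C) = (P (A `&` f @^-1` B) * law C)%E) ->
  independent_law (join_sigma G f) g law.
Proof.
move=> mg H A C JA mC; move: A JA.
have [jI jT] := (subsigmaI sG, subsigmaT sG).
apply: generated_independent.
- move=> _ _ [A1 GA1 [B1 mB1 <-]] [A2 GA2 [B2 mB2 <-]].
  exists (A1 `&` A2); first exact: jI.
  exists (B1 `&` B2); first exact: measurableI.
  by rewrite preimage_setI setIACA.
- by exists setT => //; exists setT => //; rewrite preimage_setT setTI.
- move=> A JA; have [_ ] := join_sigma_sub; apply.
  exact: sub_gen_smallest.
- by rewrite -[X in measurable X]setTI; exact: mg.
- by move=> _ [A GA [B mB <-]]; exact: H.
Qed.

End join.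

Section measurable_wrt.
Variables (G : set_system T) (sG : subsigma_algebra G).

Definition measurable_wrt (f : T -> R) : Prop :=
  forall B, measurable B -> G (f @^-1` B).

Lemma measurable_wrtP (f : T -> R) :
  measurable_wrt f <->
  measurable_fun (setT : set (g_sigma_algebraType G)) (f : _ -> R).
Proof.
split=> [Gf _ B mB|mf B mB].
  by rewrite setTI; apply: sub_gen_smallest; exact: Gf.
have : <<s G >> (f @^-1` B) by have := mf measurableT B mB; rewrite setTI.
by rewrite subsigmaE.
Qed.

Lemma measurable_wrtT f : measurable_wrt f -> measurable_fun setT f.
Proof. by move=> Gf _ B mB; rewrite setTI; case: sG => _; apply; exact: Gf. Qed.

End measurable_wrt.
End independence.

(** * Random walks along the dyadic times *)

Section dyadic_walks.
Context d (S : measurableType d) (R : realType) (P : probability S R).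
Variables left_half right_half : S -> S.
Hypothesis measurable_left_half : measurable_fun setT left_half.
Hypothesis measurable_right_half : measurable_fun setT right_half.
Hypothesis halves_law : forall B C, measurable B -> measurable C ->
  P (left_half @^-1` B `&` right_half @^-1` C) = (P B * P C)%E.
Implicit Types (s w : S) (B C : set S) (n k : nat).

(** The seed of the k-th dyadic interval of length 2^-n. At level 0, where the
    half-line is cut into infinitely many unit intervals, splitting a single
    seed again and again yields a sequence of independent seeds. *)
Fixpoint node n : nat -> S -> S :=
  if n is n'.+1 then
    fun k w => (if odd k then right_half else left_half) (node n' k./2 w)
  else fun k w => left_half (iter k right_half w).

(** The information available at the beginning of the k-th interval of level n.
    The interval 2 k of level n + 1 begins when the interval k of level n does,
    and is given the same past: at a fixed time, pasts grow with the level. *)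
Fixpoint past0 k : set_system S :=
  if k is k'.+1 then join_sigma (past0 k') (node 0 k') else <<s [set setT] >>.

Fixpoint past n : nat -> set_system S :=
  if n is n'.+1 then fun k =>
    if odd k then join_sigma (past n' k./2) (left_half \o node n' k./2)
    else past n' k./2
  else past0.

Lemma measurable_node n k : measurable_fun setT (node n k).
Proof.
elim: n k => [|n ih] k /=.
  apply: measurableT_comp; first exact: measurable_left_half.
  elim: k => [|k ihk] /=; first exact: measurable_id.
  by apply: measurableT_comp => //; exact: measurable_right_half.
by apply: measurableT_comp => //; case: ifP => _;
  [exact: measurable_right_half|exact: measurable_left_half].
Qed.

Lemma past_sigma n k : subsigma_algebra (past n k).
Proof.
elim: n k => [|n ih] k /=.
  elim: k => [|k ihk] /=; first by apply: subsigma_generated => _ ->.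
  apply: join_sigma_sub => //; exact: (measurable_node 0).
case: ifP => // _; apply: join_sigma_sub => //.
by apply: measurableT_comp; [exact: measurable_left_half|exact: measurable_node].
Qed.

Lemma node_past n k B : measurable B -> past n k.+1 (node n k @^-1` B).
Proof.
elim: n k B => [|n ih] k B mB.
  apply: (join_preimage (f := node 0 k)) => //; exact: (past_sigma 0).
rewrite /= uphalf_half; case: (boolP (odd k)) => /= ok; rewrite ?add0n ?add1n.
  by apply: (ih _ (right_half @^-1` B)); apply: measurable_preimage => //; exact: measurable_right_half.
apply: (join_preimage (f := left_half \o node n k./2)) => //; exact: past_sigma.
Qed.

Lemma past_subS n k : past n k `<=` past n k.+1.
Proof.
elim: n k => [|n ih] k; first exact: subset_join.
rewrite /= uphalf_half; case: (boolP (odd k)) => /= ok; rewrite ?add0n ?add1n.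
  apply: join_sigma_min => //; first exact: past_sigma.
  move=> B mB; rewrite comp_preimage; apply: node_past.
  by apply: measurable_preimage => //; exact: measurable_left_half.
exact: subset_join.
Qed.

Lemma past_sub n k k' : (k <= k')%N -> past n k `<=` past n k'.
Proof.
move=> /subnKC <-; elim: (k' - k)%N => [|i ih]; first by rewrite addn0.
by rewrite addnS; apply: (subset_trans ih); exact: past_subS.
Qed.

Lemma left_half_law B : measurable B -> P (left_half @^-1` B) = P B.
Proof.
move=> mB; have := halves_law mB measurableT.
by rewrite preimage_setT setIT => ->; rewrite probability_setT mule1.
Qed.

Lemma left_half_independent (G : set_system S) (V : S -> S) :
  independent_law P G V P -> independent_law P G (left_half \o V) P.
Proof.
move=> GV A B GA mB; rewrite comp_preimage GV//; last first.
  by apply: measurable_preimage => //; exact: measurable_left_half.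
by rewrite left_half_law.
Qed.

(** This is why the seed of a right half is still fresh once its left half has
    joined the past. *)
Lemma right_half_independent (G : set_system S) (V : S -> S) :
  subsigma_algebra G -> measurable_fun setT V -> independent_law P G V P ->
  independent_law P (join_sigma G (left_half \o V)) (right_half \o V) P.
Proof.
move=> sG mV GV.
apply: join_independent => //; [exact: measurableT_comp|exact: measurableT_comp|].
move=> A B C GA mB mC.
transitivity (P (A `&` V @^-1` (left_half @^-1` B `&` right_half @^-1` C))).
  by rewrite preimage_setI setIA.
rewrite GV//; last by apply: measurableI; exact: measurable_preimage.
by rewrite halves_law// muleA (left_half_independent GV).
Qed.

Lemma node_independent n k : independent_law P (past n k) (node n k) P.
Proof.
elim: n k => [|n ih] k /=; last first.
  case: ifP => _; last exact: left_half_independent.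
  apply: right_half_independent => //; [exact: past_sigma|exact: measurable_node].
apply: left_half_independent; elim: k => [|k ih] /=.
  move=> A B sA mB; move: A sA; apply: generated_independent => //.
  - by move=> _ _ -> ->; rewrite setTI.
  - by move=> _ ->.
  - by move=> _ ->; rewrite setTI probability_setT mul1e.
apply: right_half_independent => //; first exact: (past_sigma 0).
elim: k {ih} => [|k ihk] /=; first exact: measurable_id.
by apply: measurableT_comp => //; exact: measurable_right_half.
Qed.

Variable incr : S -> R.
Hypothesis measurable_incr : measurable_fun setT incr.
Hypothesis incr_law : forall B : set R, measurable B ->
  P (incr @^-1` B) = @normal_prob R 0 1 B.
Hypothesis incr_halves : forall s,
  incr s = rho * (incr (left_half s) + incr (right_half s)).
Local Notation gauss := (@normal_prob R 0 1).

Definition walk n k w : R := \sum_(j < k) incr (node n j w).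

Lemma walkS n k w : walk n k.+1 w = walk n k w + incr (node n k w).
Proof. by rewrite /walk big_ord_recr. Qed.

Lemma walk_refine n k w : rho * walk n.+1 k.*2 w = walk n k w.
Proof.
elim: k => [|k ih]; first by rewrite /walk !big_ord0 mulr0.
rewrite doubleS !walkS -ih /= odd_double doubleK uphalf_double/=.
by rewrite -addrA mulrDr -incr_halves.
Qed.

Lemma measurable_walk_past n k : measurable_wrt (past n k) (walk n k).
Proof.
apply/(measurable_wrtP (past_sigma n k)).
rewrite /walk; apply: measurable_sum => j.
apply/(measurable_wrtP (past_sigma n k)) => B mB.
apply: (@past_sub n j.+1) => //.
by apply: (node_past n j (B := incr @^-1` B)); exact: measurable_preimage.
Qed.

(** Adding one step to i steps rotates the pair of the normalized sum of the i
    steps and of the new one: the coordinates of the rotation are the square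
    roots of i / (i + 1) and of 1 / (i + 1). *)
Lemma walk_increment_independent n k i : (0 < i)%N ->
  independent_law P (past n k)
    (fun w => (walk n (k + i) w - walk n k w) / Num.sqrt i%:R) gauss.
Proof.
case: i => // i _; elim: i => [|i ih] A B GA mB.
  rewrite -incr_law// addn1 sqrtr1.
  rewrite -(node_independent GA)//; last exact: measurable_preimage.
  congr (P (A `&` _)); apply/seteqP; split => w /=;
  by rewrite walkS addrAC subrr add0r divr1.
set V := fun w => _ in ih.
pose c : R := Num.sqrt i.+1%:R / Num.sqrt i.+2%:R.
have s1 : 0 < Num.sqrt i.+1%:R :> R by rewrite sqrtr_gt0.
have s2 : 0 < Num.sqrt i.+2%:R :> R by rewrite sqrtr_gt0.
pose s : R := (Num.sqrt i.+2%:R)^-1.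
have cs : c ^+ 2 + s ^+ 2 = 1.
  rewrite exprMn !exprVn !sqr_sqrtr//.
  by field; rewrite -natr1.
have VZ w : (walk n (k + i.+2) w - walk n k w) / Num.sqrt i.+2%:R =
    c * V w + s * incr (node n (k + i.+1) w).
  rewrite /V /c /s addnS walkS; field.
  by rewrite !gt_eqF.
have mV : measurable_wrt (past n (k + i.+1)) V.
  apply/(measurable_wrtP (past_sigma n _)); apply: measurable_funM => //.
  apply: measurable_funB; apply/(measurable_wrtP (past_sigma n _)).
    exact: measurable_walk_past.
  move=> C mC; apply: (@past_sub n k); first exact: leq_addr.
  exact: measurable_walk_past.
pose E := [set p : R * R | B (c * p.1 + s * p.2)].
have mE : measurable E.
  rewrite -[X in measurable X]setTI.
  have : measurable_fun setT (fun p : R * R => c * p.1 + s * p.2).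
    by apply: measurable_funD; exact: measurable_funM.
  exact.
transitivity (P (A `&` [set w | E (V w, incr (node n (k + i.+1) w))])).
  by congr (P (_ `&` _)); apply/seteqP; split => w /=; rewrite /E/= VZ.
have GA' : past n (k + i.+1) A by apply: (@past_sub n k) => //; exact: leq_addr.
rewrite (@product_law _ _ _ _ _ _ R P gauss gauss)//.
- congr (_ * _)%E.
  have := @gauss_rotation R c s B setT _ cs mB measurableT.
  rewrite [X in (_ * X)%E]probability_setT mule1 => <-; last by rewrite invr_gt0.
  by congr (product_measure1 _ _ _); apply/seteqP; split => p //= [].
- by case: (past_sigma n k) => _; apply.
- exact: measurable_wrtT (past_sigma n _) _ mV.
- by apply: measurableT_comp => //; exact: measurable_node.
move=> B1 B2 mB1 mB2; rewrite setIA.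
rewrite -[X in P (_ `&` X)]/(node n (k + i.+1) @^-1` (incr @^-1` B2)).
rewrite node_independent//; last exact: measurable_preimage.
  by rewrite ih// incr_law// muleA.
by apply: (subsigmaI (past_sigma _ _)) => //; exact: mV.
Qed.

(** * Continuity of the limit of the walks *)

Definition tick n (t : R) : nat := Num.truncn (2 ^+ n * t).

Let truncn_le0 (x : R) : x <= 0 -> Num.truncn x = 0%N.
Proof. by move=> x0; apply/truncn0Pn; rewrite -ltNge (le_lt_trans x0). Qed.

Lemma tick_half n t : (tick n.+1 t)./2 = tick n t.
Proof.
rewrite /tick exprS -mulrA; set y := _ * t.
have [y0|y0] := ltP y 0.
  have y20 : 2 * y < 0 by rewrite pmulr_rlt0.
  by rewrite !truncn_le0// ltW.
have /andP[le1 lt1] := truncn_itv (mulr_ge0 (ler0n _ 2) y0).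
set j := Num.truncn _ in le1 lt1 *.
apply/esym/truncn_def.
have : (j./2.*2 <= j)%N by rewrite -{2}(odd_double_half j) leq_addl.
have : (j < j./2.+1.*2)%N.
  by rewrite -{1}(odd_double_half j) doubleS; case: (odd j).
rewrite -!(ler_nat R) -!muln2 !natrM; move: le1 lt1; rewrite -!natr1.
by move=> ? ? ? ?; apply/andP; split; lra.
Qed.

Lemma tick_le n (s t : R) : s <= t -> (tick n s <= tick n t)%N.
Proof. by move=> st; apply: le_truncn; rewrite ler_pM2l ?exprn_gt0. Qed.

Lemma tick_near n (s t : R) : t < s + 2 ^- n -> (tick n t <= (tick n s).+1)%N.
Proof.
move=> ts; rewrite truncn_le_nat.
have := truncnS_gt (2 ^+ n * s); rewrite -/(tick n s) -(natr1 (tick n s)) => h.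
have : 2 ^+ n * t < 2 ^+ n * (s + 2 ^- n) by rewrite ltr_pM2l// exprn_gt0.
rewrite mulrDr divff ?expf_neq0 ?pnatr_eq0// -(natr1 (tick n s).+1) -(natr1 (tick n s)).
by move: (_ * t) (_ * s) h => x y ? ?; lra.
Qed.

Lemma tick_lt n N (t : R) : (N <= n)%N -> t < 2 ^+ N -> (tick n t < 4 ^ n)%N.
Proof.
move=> Nn tN; have [t0|t0] := ltP t 0.
  by rewrite /tick truncn_le0 ?expn_gt0// pmulr_rle0 ?exprn_gt0// ltW.
rewrite truncn_lt_nat; last by rewrite mulr_ge0// exprn_ge0.
rewrite (_ : 4 = 2 * 2)%N// expnMn natrM !natrX ltr_pM2l ?exprn_gt0//.
by apply: (lt_le_trans tN); rewrite ler_eXn2l// ltr1n.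
Qed.

Lemma tick0 n : tick n 0 = 0%N.
Proof. by rewrite /tick mulr0 truncn0. Qed.

(** The walk of level n at the last dyadic time before t. *)
Definition approx n t w : R := rho ^+ n * walk n (tick n t) w.

(** Either t lies in the left half of its interval of level n, and both walks
    have the same value, or the walk of level n + 1 is one step ahead. *)
Lemma approxS n t w : approx n.+1 t w - approx n t w =
  (odd (tick n.+1 t))%:R * (rho ^+ n.+1 * incr (node n.+1 (tick n t).*2 w)).
Proof.
rewrite /approx -(walk_refine n) -(tick_half n t).
set k := tick n.+1 t; rewrite -{1}(odd_double_half k).
case: (odd k) => /=; last by rewrite add0n exprSr -!mulrA subrr mul0r.
by rewrite add1n walkS mul1r exprSr; ring.
Qed.

Definition moderate N w : Prop :=
  forall n j, (N <= n)%N -> (j < 4 ^ n)%N -> `|incr (node n j w)| <= 3 * n%:R.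

(** The factor 6 / 5 absorbs the linear bound of the steps, and is small enough
    for [decay < 1] to hold. *)
Definition decay : R := 6 / 5 * rho.

Lemma decay_gt0 : 0 < decay.
Proof. by rewrite mulr_gt0// rho_gt0. Qed.

Lemma decay_lt1 : decay < 1.
Proof.
rewrite -(@ltr_pXn2r _ 2) ?nnegrE ?ltW ?decay_gt0// expr1n exprMn rho_sqr.
by lra.
Qed.

Lemma bernoulli n : n%:R <= 5 * (6 / 5) ^+ n :> R.
Proof.
elim: n => [|n ih]; first by rewrite expr0; lra.
rewrite -natr1 exprS.
have : 1 <= (6 / 5 : R) ^+ n by rewrite exprn_ege1//; lra.
by lra.
Qed.

Lemma rho_decay n : rho ^+ n * (3 * n%:R) <= 15 * decay ^+ n.
Proof.
rewrite exprMn [leRHS]mulrA [leLHS]mulrC ler_pM2r ?exprn_gt0 ?rho_gt0//.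
by have := bernoulli n; lra.
Qed.

Section moderate_paths.
Variables (N : nat) (w : S).
Hypothesis mod_w : moderate N w.

(** With this constant, K (decay^n - decay^(n + 1)) = 15 decay^(n + 1), and the
    bounds of the successive steps telescope. *)
Let K : R := 15 * decay / (1 - decay).

Let K0 : 0 < K.
Proof. by rewrite divr_gt0 ?subr_gt0 ?decay_lt1// mulr_gt0// decay_gt0. Qed.

Lemma approx_step n t : (N <= n)%N -> t < 2 ^+ N ->
  `|approx n.+1 t w - approx n t w| <= K * (decay ^+ n - decay ^+ n.+1).
Proof.
move=> Nn tN; rewrite approxS.
have -> : K * (decay ^+ n - decay ^+ n.+1) = 15 * decay ^+ n.+1.
  by rewrite /K exprS; field; rewrite subr_eq0 eq_sym lt_eqF// decay_lt1.
have D0 : 0 <= 15 * decay ^+ n.+1.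
  by rewrite mulr_ge0// exprn_ge0// ltW// decay_gt0.
case: (boolP (odd (tick n.+1 t))) => ot; last by rewrite mul0r normr0.
rewrite mul1r normrM ger0_norm; last by rewrite exprn_ge0// ltW// rho_gt0.
apply: (le_trans _ (rho_decay n.+1)).
rewrite ler_pM2l ?exprn_gt0 ?rho_gt0//; apply: mod_w; first exact: leqW.
apply: leq_trans (tick_lt (leqW Nn) tN).
by rewrite -(odd_double_half (tick n.+1 t)) tick_half ot add1n ltnS.
Qed.

Lemma approx_dist n i t : (N <= n)%N -> t < 2 ^+ N ->
  `|approx (n + i) t w - approx n t w| <= K * (decay ^+ n - decay ^+ (n + i)).
Proof.
move=> Nn tN; elim: i => [|i ih]; first by rewrite addn0 !subrr normr0 mulr0.
have -> : approx (n + i.+1) t w - approx n t w =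
    (approx (n + i).+1 t w - approx (n + i) t w) + (approx (n + i) t w - approx n t w).
  by rewrite addnS addrA subrK.
apply: (le_trans (ler_normD _ _)).
have := approx_step (leq_trans Nn (leq_addr i n)) tN.
by move: ih; rewrite addnS; set a := `|_|; set b := `|_|; lra.
Qed.

Lemma cvg_Kdecay : (fun n => K * decay ^+ n) @ \oo --> (0 : R).
Proof.
rewrite -(mulr0 K); apply: cvgM; first exact: cvg_cst.
by apply: cvg_expr; rewrite ger0_norm ?decay_lt1// ltW// decay_gt0.
Qed.

Lemma Kdecay_small (e : R) : 0 < e -> exists2 n, (N <= n)%N & K * decay ^+ n < e.
Proof.
move=> e0; have /cvgr_lt/(_ e e0) [n _ Hn] := cvg_Kdecay.
by exists (maxn N n); [exact: leq_maxl|apply: Hn => /=; exact: leq_maxr].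
Qed.

Lemma is_cvg_approx t : t < 2 ^+ N -> cvg ((fun i => approx i t w) @ \oo).
Proof.
move=> tN; apply/cauchy_cvgP/cauchy_exP => e e0.
have [n Nn Kn] := Kdecay_small e0.
exists (approx n t w); exists n => // m /= /subnKC <-.
rewrite -ball_normE /= distrC (le_lt_trans (approx_dist _ Nn tN))//.
apply: le_lt_trans Kn; rewrite ler_pM2l// gerBl exprn_ge0// ltW//.
exact: decay_gt0.
Qed.

Lemma lim_approx_dist n t : (N <= n)%N -> t < 2 ^+ N ->
  `|limn (fun i => approx i t w) - approx n t w| <= K * decay ^+ n.
Proof.
move=> Nn tN.
have cvgA : (fun i => `|approx (n + i) t w - approx n t w|) @ \oo -->
    `|limn (fun i => approx i t w) - approx n t w|.
  apply: cvg_norm; apply: cvgB; last exact: cvg_cst.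
  have := is_cvg_approx tN; rewrite -(cvg_shiftn n).
  by under eq_fun do rewrite addnC.
rewrite -(cvg_lim _ cvgA)//; apply: limr_le; first by apply/cvg_ex; eexists; exact: cvgA.
apply: nearW => i; apply: (le_trans (approx_dist _ Nn tN)).
rewrite ler_pM2l// gerBl exprn_ge0// ltW//; exact: decay_gt0.
Qed.

Lemma approx_near n (s t : R) : (N <= n)%N -> t < 2 ^+ N -> s <= t -> t < s + 2 ^- n ->
  `|approx n t w - approx n s w| <= 15 * decay ^+ n.
Proof.
move=> Nn tN st ts; rewrite /approx -mulrBr normrM ger0_norm; last first.
  by rewrite exprn_ge0// ltW// rho_gt0.
apply: (le_trans _ (rho_decay n)).
rewrite ler_pM2l ?exprn_gt0 ?rho_gt0//.
have := tick_near ts; rewrite leq_eqVlt ltnS => /predU1P[e|ts'].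
  rewrite e walkS addrAC subrr add0r; apply: mod_w => //.
  by apply: leq_trans (tick_lt Nn tN); rewrite e.
have -> : tick n t = tick n s by apply/eqP; rewrite eqn_leq ts' tick_le.
by rewrite subrr normr0.
Qed.

Lemma lim_approx_near n (s t : R) : (N <= n)%N -> t < 2 ^+ N -> s <= t -> t < s + 2 ^- n ->
  `|limn (fun i => approx i t w) - limn (fun i => approx i s w)| <= (2 * K + 15) * decay ^+ n.
Proof.
move=> Nn tN st ts; have sN := le_lt_trans st tN.
have := lim_approx_dist Nn tN; have := lim_approx_dist Nn sN.
have := approx_near Nn tN st ts.
move: (limn _) (limn _) (approx n t w) (approx n s w) (decay ^+ n) => a b x y D.
rewrite !ler_norml => /andP[? ?] /andP[? ?] /andP[? ?].
by apply/andP; split; lra.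
Qed.

End moderate_paths.

Definition large n : set S :=
  \bigcup_(j in `I_(4 ^ n)) [set w | 3 * n%:R < `|incr (node n j w)|].

Definition regular : set S := ~` lim_sup_set large.

Lemma measurable_large n : measurable (large n).
Proof.
apply: bigcup_measurable => j _.
rewrite -[X in measurable X]setTI.
rewrite (_ : [set w | _] = (fun w => `|incr (node n j w)|) @^-1` `](3 * n%:R), +oo[).
  have : measurable_fun setT (fun w => `|incr (node n j w)|).
    apply: measurableT_comp; first exact: normr_measurable.
    by apply: measurableT_comp => //; exact: measurable_node.
  by apply => //; exact: measurable_itv.
by apply/seteqP; split => w /=; rewrite in_itv/= andbT.
Qed.

Lemma measurable_regular : measurable regular.
Proof.
apply: measurableC; apply: bigcapT_measurable => k.
by apply: bigcup_measurable => n _; exact: measurable_large.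
Qed.

Lemma moderate_le N N' w : (N <= N')%N -> moderate N w -> moderate N' w.
Proof. by move=> NN' H n j N'n; apply: H; exact: leq_trans N'n. Qed.

Lemma regular_moderate w (t : R) : regular w -> exists2 N, moderate N w & t < 2 ^+ N.
Proof.
move=> rw; have [N modN] : exists N, moderate N w.
  apply: contrapT => /forallNP H; apply: rw => N _.
  apply: contrapT => NL; apply: (H N) => n j Nn j4.
  rewrite leNgt; apply/negP => wl; apply: NL.
  by exists n => //; exists j.
exists (maxn N (Num.truncn t).+1); first exact: moderate_le (leq_maxl _ _) modN.
apply: (lt_le_trans (truncnS_gt t)).
apply: (@le_trans _ _ (2 ^+ (Num.truncn t).+1)).
  by rewrite -natrX ler_nat ltnW// ltn_expl.
by rewrite ler_eXn2l ?leq_maxr// ltr1n.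
Qed.

(** The indicator replaces the paths that may fail to be continuous by the
    constant path 0. *)
Definition path t w : R := limn (fun n => \1_regular w * approx n t w).

Lemma path_regular t w : regular w -> path t w = limn (fun n => approx n t w).
Proof.
move=> rw; rewrite /path.
rewrite (_ : (fun n => _ * _) = (fun n => approx n t w))//; apply/funext => n.
by rewrite indicE mem_set// mul1r.
Qed.

Lemma path_irregular t w : ~ regular w -> path t w = 0.
Proof.
move=> rw; rewrite /path (_ : (fun n => _) = cst 0) ?lim_cst//.
by apply/funext => n; rewrite indicE memNset// mul0r.
Qed.

Lemma cvg_approx t w : regular w -> (fun n => approx n t w) @ \oo --> path t w.
Proof.
move=> rw; rewrite path_regular//.
by have [N modN tN] := regular_moderate t rw; exact: (is_cvg_approx modN tN).
Qed.

Lemma cvg_path t w : (fun n => \1_regular w * approx n t w) @ \oo --> path t w.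
Proof.
have [rw|rw] := pselect (regular w).
  rewrite (_ : (fun n => _) = (fun n => approx n t w)); first exact: cvg_approx.
  by apply/funext => n; rewrite indicE mem_set// mul1r.
rewrite path_irregular// (_ : (fun n => _) = cst 0); first exact: cvg_cst.
by apply/funext => n; rewrite indicE memNset// mul0r.
Qed.

Lemma path0 w : path 0 w = 0.
Proof.
rewrite /path (_ : (fun n => _) = cst 0) ?lim_cst//.
by apply/funext => n; rewrite /approx tick0 /walk big_ord0 !mulr0.
Qed.

Lemma continuous_path w : continuous (fun t => path t w).
Proof.
have [rw|rw] := pselect (regular w); last first.
  rewrite (_ : (fun t => _) = cst 0); first exact: cst_continuous.
  by apply/funext => t; rewrite path_irregular.
move=> t0; have [N modN t0N] := regular_moderate (t0 + 1) rw.
apply/cvgrPdist_le => e e0.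
(* the modulus of continuity of [lim_approx_near] *)
pose L : R := 2 * (15 * decay / (1 - decay)) + 15.
have L0 : 0 < L.
  by rewrite addr_gt0// mulr_gt0// divr_gt0 ?subr_gt0 ?decay_lt1// mulr_gt0// decay_gt0.
have [n Nn Ln] : exists2 n, (N <= n)%N & L * decay ^+ n <= e.
  have cvgL : (fun n => L * decay ^+ n) @ \oo --> (0 : R).
    rewrite -(mulr0 L); apply: cvgM; first exact: cvg_cst.
    by apply: cvg_expr; rewrite ger0_norm ?decay_lt1// ltW// decay_gt0.
  have /cvgr_lt/(_ e e0) [n _ Hn] := cvgL.
  by exists (maxn N n); [exact: leq_maxl|rewrite ltW//; apply: Hn => /=; exact: leq_maxr].
near=> t; apply: le_trans Ln; rewrite !path_regular//.
have n0 : 0 < 2 ^- n :> R by rewrite invr_gt0 exprn_gt0.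
have tt0 : `|t0 - t| < 2 ^- n by near: t; exact: cvgr_dist_lt.
have tt01 : `|t0 - t| < 1 by near: t; exact: cvgr_dist_lt.
have [le|/ltW le] := leP t t0.
  apply: (lim_approx_near modN Nn) => //; first by rewrite (lt_trans _ t0N)// ltrDl.
  by move: tt0; rewrite ger0_norm ?subr_ge0// ltrBlDl.
rewrite distrC; apply: (lim_approx_near modN Nn) => //.
  rewrite (lt_trans _ t0N)//; move: tt01; rewrite distrC ger0_norm ?subr_ge0//.
  by rewrite ltrBlDl.
by move: tt0; rewrite distrC ger0_norm ?subr_ge0// ltrBlDl.
Unshelve. all: by end_near. Qed.

Lemma measurable_approx n t : measurable_fun setT (approx n t).
Proof.
apply: measurable_funM => //; apply: (measurable_wrtT (past_sigma n _)).
exact: measurable_walk_past.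
Qed.

Lemma measurable_path t : measurable_fun setT (path t).
Proof.
apply: (measurable_fun_cvg (h := fun n w => \1_regular w * approx n t w)).
- move=> n; apply: measurable_funM; last exact: measurable_approx.
  exact/measurable_indic/measurable_regular.
- by move=> w _; exact: cvg_path.
Qed.

Lemma node_law n k B : measurable B -> P (node n k @^-1` B) = P B.
Proof.
move=> mB; have := node_independent (subsigmaT (past_sigma n k)) mB.
by rewrite setTI probability_setT mul1e.
Qed.

Let measurable_tail (c : R) : measurable [set x : R | c < `|x|].
Proof.
rewrite (_ : [set x | _] = Num.norm @^-1` `]c, +oo[); last first.
  by apply/seteqP; split => x /=; rewrite in_itv/= andbT.
rewrite -[X in measurable X]setTI.
have mn : measurable_fun setT (@Num.norm R R) := @normr_measurable R setT.
by apply: mn => //; exact: measurable_itv.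
Qed.

(** There are 4^n steps, each exceeding 3 n with probability at most a constant
    times expR (- 3 n), and 4 expR (- 3) <= 1 / 2. *)
Lemma large_le n : (P (large n) <= (2 * expR (1 / 2) * (1 / 2) ^+ n)%:E)%E.
Proof.
have mtail := measurable_tail (3 * n%:R).
have mincr : measurable (incr @^-1` [set x | 3 * n%:R < `|x|]) by exact: measurable_preimage.
have mlarge j : measurable (node n j @^-1` (incr @^-1` [set x | 3 * n%:R < `|x|])).
  by apply: measurable_preimage mincr; exact: measurable_node.
rewrite /large bigcup_mkord.
apply: (le_trans (@Boole_inequality _ _ _ P _ (4 ^ n) (fun j _ => mlarge j))).
apply: (@le_trans _ _ (\sum_(j < 4 ^ n) (2 * expR (1 / 2 - 3 * n%:R))%:E)%E).
  apply: lee_sum => j _; apply: le_trans (gauss_tail _).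
  by rewrite -incr_law// -(node_law n j).
rewrite sumEFin lee_fin sumr_const card_ord -[leLHS]mulr_natr -!mulrA ler_pM2l//.
rewrite expRD -mulrA ler_pM2l ?expR_gt0// natrX.
have e8 : expR (- 3) <= 1 / 8 :> R.
  rewrite expRN -div1r ler_pdivrMr ?expR_gt0//.
  have e2 : 2 <= expR 1 :> R by have := @expR_ge1Dx R 1; lra.
  have -> : (3 : R) = 1 + 1 + 1 by lra.
  rewrite !expRD; move: (expR 1) e2 => e e2.
  have : 4 <= e * e by nra.
  by move=> e4; nra.
rewrite -mulNr mulrC (_ : - 3 * n%:R = n%:R * - 3); last by rewrite mulrC.
rewrite expRM_natl -exprMn; apply: lerXn2r; rewrite ?nnegrE.
- by rewrite mulr_ge0// expR_ge0.
- by [].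
- by lra.
Qed.

Lemma P_regular : P regular = 1%E.
Proof.
rewrite probability_setC; last first.
  apply: bigcapT_measurable => k.
  by apply: bigcup_measurable => n _; exact: measurable_large.
rewrite lim_sup_set_cvg0 ?sube0//; first exact: measurable_large.
apply: (@le_lt_trans _ _ (2 * (2 * expR (1 / 2)))%:E); last by rewrite ltry.
apply: lime_le; first exact: is_cvg_nneseries.
apply: nearW => n.
apply: (@le_trans _ _ (\sum_(0 <= i < n) (2 * expR (1 / 2) * (1 / 2) ^+ i)%:E)%E).
  by apply: lee_sum => i _; exact: large_le.
rewrite sumEFin lee_fin -mulr_sumr [leRHS]mulrC ler_pM2l ?mulr_gt0 ?expR_gt0//.
suff -> : \sum_(0 <= i < n) (1 / 2) ^+ i = 2 - 2 * (1 / 2) ^+ n :> R.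
  by rewrite gerBl mulr_ge0// exprn_ge0.
elim: n => [|n ih]; first by rewrite big_geq// expr0 mulr1 subrr.
by rewrite big_nat_recr//= ih exprS; lra.
Qed.

Lemma P_setI_regular A : measurable A -> P (A `&` regular) = P A.
Proof.
move=> mA; have mr := measurable_regular.
have : P (A `&` ~` regular) = 0%E.
  apply/eqP; rewrite eq_le measure_ge0 andbT.
  apply: (@le_trans _ _ (P (~` regular))).
    apply: le_measure; rewrite ?inE//; first apply: measurableI => //.
    - exact: measurableC.
    - exact: measurableC.
  by rewrite probability_setC// P_regular subee.
move=> PA0; rewrite -[in RHS](setIT A) -(setUv regular) setIUr measureU0//.
- exact: measurableI.
- by apply: measurableI => //; exact: measurableC.
Qed.

(** * Increments of the limit *)

Definition ticks m (s t : R) : nat := (tick m (s + t) - tick m s)%N.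

Lemma ticks_approx m (s t : R) : 0 <= s -> 0 <= t ->
  `|(ticks m s t)%:R - 2 ^+ m * t| <= 1.
Proof.
move=> s0 t0; rewrite natrB; last by apply: tick_le; rewrite lerDl.
have p0 : 0 <= 2 ^+ m :> R by rewrite exprn_ge0.
have /andP[] := truncn_itv (mulr_ge0 p0 s0).
have /andP[] := truncn_itv (mulr_ge0 p0 (addr_ge0 s0 t0)).
rewrite -/(tick m s) -/(tick m (s + t)) -(natr1 (tick m s)) -(natr1 (tick m (s + t))).
rewrite mulrDr ler_norml; move: (_ * s) (_ * t) => x y ? ? ? ?.
by apply/andP; split; lra.
Qed.

Lemma cvg_pow2V : (fun m => 2 ^- m) @ \oo --> (0 : R).
Proof.
rewrite (_ : (fun m => _) = (fun m => (1 / 2) ^+ m)); last first.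
  by apply/funext => m; rewrite div1r exprVn.
by apply: cvg_expr; rewrite ger0_norm//; lra.
Qed.

Lemma ticks_ratio m (s t : R) : 0 <= s -> 0 <= t ->
  `|(ticks m s t)%:R / 2 ^+ m - t| <= 2 ^- m.
Proof.
move=> s0 t0; have p0 : 0 < 2 ^+ m :> R by rewrite exprn_gt0.
have -> : (ticks m s t)%:R / 2 ^+ m - t = ((ticks m s t)%:R - 2 ^+ m * t) / 2 ^+ m.
  by rewrite mulrBl mulrAC divff ?mul1r// lt0r_neq0.
rewrite normrM (@ger0_norm _ (_^-1)) ?invr_ge0 ?(ltW p0)//.
by rewrite -[leRHS]mul1r ler_pM2r ?invr_gt0// ticks_approx.
Qed.

Lemma cvg_ticks (s t : R) : 0 <= s -> 0 <= t ->
  (fun m => (ticks m s t)%:R / 2 ^+ m) @ \oo --> t.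
Proof.
move=> s0 t0; apply/cvgrPdist_le => e e0; near=> m.
rewrite distrC (le_trans (ticks_ratio _ _ _))//.
by near: m; have /cvgr_le := cvg_pow2V; apply.
Unshelve. all: by end_near. Qed.

Lemma ticks_gt0 (s t : R) : 0 <= s -> 0 < t -> exists M, forall m, (M <= m)%N ->
  (0 < ticks m s t)%N.
Proof.
move=> s0 t0; have /cvgr_lt/(_ _ t0) [M _ HM] := cvg_pow2V.
exists M => m Mm; rewrite lt0n; apply/eqP => i0.
have := ticks_ratio m s0 (ltW t0); rewrite i0 mul0r sub0r normrN ger0_norm; last exact: ltW.
by rewrite leNgt HM.
Qed.

Lemma rho_sqrt m i : rho ^+ m * Num.sqrt i%:R = Num.sqrt (i%:R / 2 ^+ m) :> R.
Proof.
rewrite sqrtrM// mulrC; congr (_ * _).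
rewrite sqrtrV ?exprn_ge0// /rho exprVn; congr (_^-1).
elim: m => [|m ih]; first by rewrite !expr0 sqrtr1.
by rewrite !exprS sqrtrM// ih.
Qed.

Lemma past_refine n i (s : R) : past n (tick n s) `<=` past (n + i) (tick (n + i) s).
Proof.
elim: i => [|i ih]; first by rewrite addn0.
apply: (subset_trans ih); rewrite addnS.
have -> : past (n + i) (tick (n + i) s) =
    past (n + i).+1 (tick (n + i) s).*2.
  by rewrite /= odd_double doubleK.
apply: past_sub; rewrite -tick_half -[leqRHS]odd_double_half.
exact: leq_addl.
Qed.

(** The increment is the limit of increments of the walks, which, divided by
    the square root of their number of steps, are exactly standard normal. *)
Lemma path_increment_past n (s t : R) A (B : set R) : 0 <= s -> 0 < t ->
  past n (tick n s) A -> measurable B ->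
  P (A `&` regular `&`
    (fun w => (path (s + t) w - path s w) / Num.sqrt t) @^-1` B) =
  (P (A `&` regular) * gauss B)%E.
Proof.
move=> s0 t0 pA mB.
have mA : measurable A by case: (past_sigma n (tick n s)) => _; apply.
have [M ticksM] := ticks_gt0 s0 t0.
(* from level n + M on, A belongs to the past of time s and at least one step
   separates s from s + t *)
pose m j := (n + (M + j))%N.
have tick_pos j : (0 < ticks (m j) s t)%N.
  by apply: ticksM; rewrite /m addnCA leq_addr.
pose Y_ j w := (walk (m j) (tick (m j) s + ticks (m j) s t) w
  - walk (m j) (tick (m j) s) w) / Num.sqrt (ticks (m j) s t)%:R.
have tickD j : (tick (m j) s + ticks (m j) s t)%N = tick (m j) (s + t).
  by rewrite /ticks subnKC// tick_le// lerDl ltW.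
have YE j w : Y_ j w = (approx (m j) (s + t) w - approx (m j) s w) /
    Num.sqrt ((ticks (m j) s t)%:R / 2 ^+ (m j)).
  rewrite /Y_ tickD -rho_sqrt /approx -mulrBr invfM mulrACA divff ?mul1r//.
  by rewrite expf_neq0// gt_eqF// rho_gt0.
have mwalk j k : measurable_fun setT (walk j k).
  apply: (measurable_wrtT (past_sigma j k)); exact: measurable_walk_past.
rewrite -[in RHS](preimage_id B).
apply: (@limit_independent _ _ _ _ R P gauss _ Y_ _ (fun=> id)) => //.
- by apply: measurableI => //; exact: measurable_regular.
- by move=> j; apply: measurable_funM => //; exact: measurable_funB.
- apply: measurable_funM => //.
  by apply: measurable_funB; exact: measurable_path.
- move=> w [_ rw]; rewrite (_ : Y_ ^~ w = fun j => (approx (m j) (s + t) w -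
      approx (m j) s w) / Num.sqrt ((ticks (m j) s t)%:R / 2 ^+ (m j))); last first.
    by apply/funext => j; exact: YE.
  have cvgm (u : nat -> R) (l : R) : u @ \oo --> l -> (fun j => u (m j)) @ \oo --> l.
    rewrite -(cvg_shiftn (n + M) u).
    by rewrite (_ : (fun j => u (m j)) = (fun j => u (j + (n + M))%N))//;
      apply/funext => j; rewrite /m addnA addnC.
  have cvga u : (fun j => approx (m j) u w) @ \oo --> path u w.
    by apply: (cvgm (fun j => approx j u w)); exact: cvg_approx.
  apply: (@cvgM _ _ _ _ (fun j => approx (m j) (s + t) w - approx (m j) s w)
    (fun j => (Num.sqrt ((ticks (m j) s t)%:R / 2 ^+ (m j)))^-1)).
    exact: cvgB.
  apply: (cvgm (fun j => (Num.sqrt ((ticks j s t)%:R / 2 ^+ j))^-1)).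
  apply: cvgV; first by rewrite gt_eqF// sqrtr_gt0.
  apply: (@cvg_comp _ _ _ (fun j => (ticks j s t)%:R / 2 ^+ j) Num.sqrt).
    exact: (cvg_ticks s0 (ltW t0)).
  exact: sqrt_continuous.
- by move=> r; exact: cvg_cst.
move=> j C mC; rewrite preimage_id.
have mYC : measurable (Y_ j @^-1` C).
  by apply: measurable_preimage => //; apply: measurable_funM => //; exact: measurable_funB.
rewrite setIAC P_setI_regular ?P_setI_regular//; last exact: measurableI.
apply: walk_increment_independent => //.
exact: (@past_refine n (M + j) s _ pA).
Qed.

(** Intersecting with [regular] makes the paths themselves, and not only the
    walks, measurable with respect to the generated sigma-algebra. *)
Let history (s : R) : set_system S :=
  [set A `&` E | A in \bigcup_n past n (tick n s) & E in [set setT; regular]].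

Let history_sub (s : R) : history s `<=` measurable.
Proof.
move=> _ [A [n _ pA] [E ET <-]]; apply: measurableI.
  by case: (past_sigma n (tick n s)) => _; apply.
by case: ET => ->//; exact: measurable_regular.
Qed.

Let historyI (s : R) : setI_closed (history s).
Proof.
move=> _ _ [A1 [n1 _ pA1] [E1 ET1 <-]] [A2 [n2 _ pA2] [E2 ET2 <-]].
exists (A1 `&` A2).
  exists (n1 + n2)%N => //; apply: (subsigmaI (past_sigma _ _)).
    exact: past_refine.
  by rewrite addnC; exact: past_refine.
exists (E1 `&` E2); last by rewrite setIACA.
case: ET1 => ->; case: ET2 => ->; rewrite ?setTI ?setIT ?setIid;
  by [left|right].
Qed.

Let historyT (s : R) : history s setT.
Proof.
exists setT; first by exists 0%N => //; exact: (subsigmaT (past_sigma 0 _)).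
by exists setT; [left|rewrite setIT].
Qed.

Lemma path_increment_history (s t : R) : 0 <= s -> 0 < t ->
  independent_law P <<s history s >>
    (fun w => (path (s + t) w - path s w) / Num.sqrt t) gauss.
Proof.
move=> s0 t0 A B hA mB; move: A hA.
have mV : measurable
    ((fun w => (path (s + t) w - path s w) / Num.sqrt t) @^-1` B).
  apply: measurable_preimage => //; apply: measurable_funM => //.
  by apply: measurable_funB; exact: measurable_path.
apply: generated_independent.
- exact: historyI.
- exact: historyT.
- exact: history_sub.
- exact: mV.
move=> _ [A [n _ pA] [E ET <-]].
have mA : measurable A by case: (past_sigma n (tick n s)) => _; apply.
have mE : measurable E by case: ET => ->//; exact: measurable_regular.
have ER : E `&` regular = regular by case: ET => ->; rewrite ?setTI ?setIid.
have mAE : measurable (A `&` E) by exact: measurableI.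
rewrite -(P_setI_regular mAE) -[in LHS]P_setI_regular; last exact: measurableI.
have AER : A `&` E `&` regular = A `&` regular by rewrite -setIA ER.
set V := _ @^-1` B.
have -> : A `&` E `&` V `&` regular = A `&` regular `&` V by rewrite setIAC AER.
rewrite AER; exact: (path_increment_past s0 t0 pA).
Qed.

Lemma path_history (s u : R) (B : set R) : 0 <= u <= s -> measurable B ->
  <<s history s >> (path u @^-1` B).
Proof.
move=> /andP[u0 us] mB.
have sH : subsigma_algebra <<s history s >>.
  by apply: subsigma_generated; exact: history_sub.
suff : measurable_wrt <<s history s >> (path u) by apply.
apply/(measurable_wrtP sH).
apply: (@measurable_fun_cvg _ (g_sigma_algebraType <<s history s >>) R setT
  (fun n w => \1_regular w * approx n u w)); last first.
  by move=> w _; exact: cvg_path.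
move=> n; apply: measurable_funM.
  apply: measurable_indic; do 2 apply: sub_gen_smallest; exists setT.
    by exists 0%N => //; exact: (subsigmaT (past_sigma 0 _)).
  by exists regular; [right|rewrite setTI].
apply/(measurable_wrtP sH) => C mC; apply: sub_gen_smallest.
exists (approx n u @^-1` C); last by exists setT; [left|rewrite setIT].
exists n => //; apply: (past_sub (tick_le n us)).
have : measurable_wrt (past n (tick n u)) (approx n u); last by apply.
apply/(measurable_wrtP (past_sigma n _)); apply: measurable_funM => //.
by apply/(measurable_wrtP (past_sigma n _)); exact: measurable_walk_past.
Qed.

Theorem path_brownian :
  [/\ forall t, measurable_fun setT (path t),
      forall w, path 0 w = 0,
      forall w, continuous (fun t => path t w)
    & forall s t : R, 0 <= s -> 0 < t -> independent_law P
        <<s [set path u @^-1` B | u in [set u | 0 <= u <= s] & B in measurable] >>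
        (fun w => (path (s + t) w - path s w) / Num.sqrt t) gauss].
Proof.
split; [exact: measurable_path|exact: path0|exact: continuous_path|].
move=> s t s0 t0 A B hA mB; apply: path_increment_history => //.
apply: hA; split; first exact: smallest_sigma_algebra.
by move=> _ [u /= us [C mC <-]]; exact: path_history.
Qed.

End dyadic_walks.

(** * Wiener processes *)

Theorem brownian_motion_exists (R : realType) :
  exists (d : measure_display) (S : measurableType d) (P : probability S R)
    (W : R -> S -> R),
  [/\ forall t, measurable_fun setT (W t),
      forall w, W 0 w = 0,
      forall w, continuous (fun t => W t w)
    & forall s t : R, 0 <= s -> 0 < t -> independent_law P
        <<s [set W u @^-1` B | u in [set u | 0 <= u <= s] & B in measurable] >>
        (fun w => (W (s + t) w - W s w) / Num.sqrt t) (@normal_prob R 0 1)].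
Proof.
pose S := (measurableTypeR R * measurableTypeR R)%type.
exists _, S, (@seed R), (path (@left_half R) (@right_half R) (fst : S -> R)).
apply: path_brownian.
- exact: measurable_left_half.
- exact: measurable_right_half.
- exact: seed_halves.
- exact: measurable_fst.
- move=> B mB; rewrite (_ : fst @^-1` B = B `*` setT); last first.
    by apply/seteqP; split => s //= [].
  rewrite [LHS]product_measure1E// [X in (_ * X)%E]probability_setT mule1//.
- move=> s; rewrite halves_sum mulrA mulrA -expr2 rho_sqr.
  by rewrite div1r mulVf ?mul1r// pnatr_eq0.
Qed.

(** The point w, known through G, may be frozen while the independent variable
    Z is integrated out: the pair (w, Z w) has a product law on the product of T,
    equipped with the sigma-algebra G, and of U. *)
Lemma freezing d (T : measurableType d) (R : realType) (P : probability T R)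
    d' (U : measurableType d') (G : set_system T) (Z : T -> U)
    (law : probability U R) : subsigma_algebra G -> measurable_fun setT Z ->
  independent_law P G Z law ->
  forall E : set (g_sigma_algebraType G * U), measurable E ->
  P [set w | E (w, Z w)] = (\int[P]_w law (xsection E w))%E.
Proof.
move=> sG mZ GZ E mE.
have GE := subsigmaE sG; have [_ Gm] := sG.
have mid : measurable_fun setT (idfun : T -> g_sigma_algebraType G).
  move=> _ B mB; rewrite setTI preimage_id; apply: Gm.
  by rewrite -[X in X B]GE.
have mpair : measurable_fun setT
    (fun w => (w, Z w) : g_sigma_algebraType G * U).
  exact: (measurable_fun_pair mid mZ).
pose m1 := image_measure P mid.
transitivity ((m1 \x law)%E E); last first.
  rewrite /product_measure1.
  have := @ge0_integral_pushforward _ _ _ _ R _ mid P setT (law \o xsection E) measurableT.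
  rewrite preimage_setT => -> //; last first.
  exact: measurable_fun_xsection.
rewrite -[LHS]/(image_measure P mpair E).
apply: (measure_unique [set B `*` C | B in measurable & C in measurable]
    (fun n => setT)) => //.
- exact: measurable_prod_measurableType.
- move=> _ _ [B1 mB1 [C1 mC1 <-]] [B2 mB2 [C2 mC2 <-]].
  exists (B1 `&` B2); first exact: measurableI.
  by exists (C1 `&` C2); [exact: measurableI|rewrite setXI].
- by move=> n; exists setT => //; exists setT => //; rewrite setXTT.
- by rewrite -subTset => x _; exists 0%N.
- move=> _ [B mB [C mC <-]].
  transitivity (m1 B * law C)%E; last exact/esym/product_measure1E.
  rewrite -[RHS]/(P B * law C)%E -GZ//.
  by rewrite -[X in X B]GE.
- by move=> n; rewrite [ltLHS](_ : _ = P setT)// probability_setT ltry.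
Qed.

Section wiener_one.
Context {R : realType}.
Local Notation gauss := (@normal_prob R 0 1).
Implicit Types (s t x : R).

Lemma wiener1_affine t x (B : set R) : 0 < t -> measurable B ->
  wiener1 t x B = gauss ((fun z => x + Num.sqrt t * z) @^-1` B).
Proof.
by move=> t0 mB; rewrite /wiener1 gt_eqF// normal_affine// sqrtr_gt0.
Qed.

Definition tuple1 (a : R) : 1.-tuple R := [tuple a | i < 1].

Lemma tuple1E (a : R) (y : 0.-tuple R) : tcons (a, y) = tuple1 a.
Proof.
apply: eq_from_tnth => i; rewrite (ord1 i) tnth_mktuple.
by rewrite (tnth_nth 0).
Qed.

Lemma thead_tuple1 a : thead (tuple1 a) = a.
Proof. by rewrite /thead tnth_mktuple. Qed.

Lemma measurable_tuple1 : measurable_fun setT tuple1.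
Proof.
rewrite (_ : tuple1 = @tcons R 0 \o (fun a => (a, [tuple]))).
  apply: measurableT_comp; first exact: measurable_tcons.
  exact: measurable_fun_pair.
by apply/funext => a /=; rewrite tuple1E.
Qed.

Lemma wiener_tuple1 t (y : 1.-tuple R) (B : set (1.-tuple R)) : measurable B ->
  wiener t y B = wiener1 t (thead y) (tuple1 @^-1` B).
Proof.
move=> mB; rewrite /= /distribution /pushforward.
have mB1 : measurable (tuple1 @^-1` B).
  by rewrite -[X in measurable X]setTI; exact: measurable_tuple1.
rewrite (_ : @tcons R 0 @^-1` B = (tuple1 @^-1` B) `*` setT); last first.
  by apply/seteqP; split => [[a z]|[a z]] /=; rewrite tuple1E// => -[].
rewrite product_measure1E// [X in (_ * X)%E](_ : _ = 1%E) ?mule1//.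
exact: (@probability_setT _ _ _ (wiener t [tuple of behead y])).
Qed.

(** Given the past up to time s, W (s + t) is the sum of the known value W s and
    of an independent normal variable with variance t. *)
Lemma brownian_Feller d (S : measurableType d) (P : probability S R)
    (W : R -> S -> R) x :
  (forall t, measurable_fun setT (W t)) -> (forall w, W 0 w = 0) ->
  (forall s t : R, 0 <= s -> 0 < t -> independent_law P
    <<s [set W u @^-1` B | u in [set u | 0 <= u <= s] & B in measurable] >>
    (fun w => (W (s + t) w - W s w) / Num.sqrt t) gauss) ->
  Feller_process P (fun t y => wiener t y) (tuple1 x)
    (fun t w => tuple1 (x + W t w)).
Proof.
move=> mW W0 indW; split.
- move=> t _; apply: (measurableT_comp measurable_tuple1).
  exact: measurable_funD.
- rewrite (_ : [set w | _] = setT) ?probability_setT//.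
  by apply/seteqP; split => w //= _; rewrite W0 addr0.
move=> s t A B s0 t0 FA mB.
set F := <<s [set W u @^-1` B | u in [set u | 0 <= u <= s] & B in measurable] >>.
have sF : subsigma_algebra F.
  apply: subsigma_generated => _ [u _ [C mC <-]].
  by rewrite -[X in measurable X]setTI; exact: mW.
have FFA : F A.
  apply: FA; split; first exact: smallest_sigma_algebra.
  move=> _ [u us [C mC <-]]; apply: sub_gen_smallest; exists u => //.
  exists ((fun a => tuple1 (x + a)) @^-1` C) => //.
  rewrite -[X in measurable X]setTI.
  have : measurable_fun setT (fun a : R => tuple1 (x + a)).
    by apply: (measurableT_comp measurable_tuple1); exact: measurable_funD.
  exact.
have mA : measurable A by case: sF => _; apply.
pose C := tuple1 @^-1` B.
have mC : measurable C.
  by rewrite -[X in measurable X]setTI; exact: measurable_tuple1.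
under eq_integral do rewrite wiener_tuple1// thead_tuple1.
have [t_eq0|t_neq0] := eqVneq t 0.
  rewrite t_eq0 addr0.
  transitivity (\int[P]_(w in A) (\1_((fun w => x + W s w) @^-1` C) w)%:E)%E.
    rewrite integral_indic//; last first.
      rewrite -[X in measurable X]setTI.
      have : measurable_fun setT (fun w => x + W s w) by exact: measurable_funD.
      exact.
    by rewrite setIC.
  apply: eq_integral => w _; rewrite /wiener1 eqxx diracE indicE.
  suff -> : (x + W s w \in C) = (w \in (fun w => x + W s w) @^-1` C) by [].
  by apply/idP/idP; rewrite !inE.
have tp : 0 < t by rewrite lt_neqAle eq_sym t_neq0.
pose Z w := (W (s + t) w - W s w) / Num.sqrt t.
have mZ : measurable_fun setT Z.
  by apply: measurable_funM => //; exact: measurable_funB.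
pose E : set (g_sigma_algebraType F * measurableTypeR R) :=
  [set p | A p.1 /\ C (x + W s p.1 + Num.sqrt t * p.2)].
have mE : measurable E.
  apply: measurableI.
    rewrite -[X in measurable X]setTI; apply: measurable_fst => //.
    exact: sub_gen_smallest.
  rewrite -[X in measurable X]setTI.
  have : measurable_fun setT (fun p : g_sigma_algebraType F * measurableTypeR R =>
      x + W s p.1 + Num.sqrt t * p.2).
    apply: measurable_funD; last exact: measurable_funM.
    apply: measurable_funD => //; apply: measurableT_comp => //.
    apply/(measurable_wrtP sF) => D mD; apply: sub_gen_smallest.
    by exists s; [rewrite /= s0 lexx|exists D].
  exact.
transitivity (P [set w | E (w, Z w)]).
  congr (P _); apply/seteqP; split => w /=; rewrite /E/= /Z mulrC divfK;
  rewrite ?gt_eqF ?sqrtr_gt0// -addrA (addrC (W s w)) subrK//.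
rewrite (@freezing _ _ R P _ (measurableTypeR R) F Z gauss sF mZ (indW _ _ s0 tp) E mE).
rewrite [RHS]integral_mkcond; apply: eq_integral => w _.
rewrite /patch; case: ifPn => [/set_mem Aw|/negP nAw].
  rewrite wiener1_affine//; congr (gauss _).
  apply/seteqP; split => z /=; rewrite /xsection/= inE /E/=; first by case.
  by move=> Cz; split.
rewrite (_ : xsection E w = set0) ?measure0//.
apply/seteqP; split => z //=; rewrite /xsection/= inE /E/= => -[Aw _].
by apply: nAw; exact: mem_set.
Qed.

End wiener_one.

(** * The flow *)

Section arratia.
Context {R : realType}.
Context (Q : forall n : nat, R -> R.-pker (n.-tuple R) ~> (n.-tuple R)).
Context (d : measure_display) (T : measurableType d) (P : probability T R).
Context (theta : R -> T -> T) (phi : R -> T -> R -> R).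
Hypothesis HQ : coalescing_semigroups Q.
Hypothesis Hphi : Arratia_rds P Q theta phi.
Local Notation gauss := (@normal_prob R 0 1).

Lemma phi0 w x : phi 0 w x = x.
Proof.
have [[_ th0 _ _] _ _ [[_ _ psi_id _ _] _] _] := Hphi.
by have := psi_id 0 x w; rewrite subrr th0.
Qed.

(** Two trajectories that cross meet, and then stay together. *)
Lemma phi_monotone t w x y : 0 <= t -> x <= y -> phi t w x <= phi t w y.
Proof.
move=> t0 xy; have [_ _ cocycle _ cphi] := Hphi.
rewrite leNgt; apply/negP => yx.
pose f s := phi s w y - phi s w x.
have cf : {within `[0, t], continuous f}.
  have sub : [set` `[0, t]] `<=` [set` `[0, +oo[] by exact: subset_itvl.
  move=> s; apply: (@cvgB _ R^o).
    exact: (continuous_subspaceW sub (cphi w y)).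
  exact: (continuous_subspaceW sub (cphi w x)).
have ft : f t < 0 by rewrite /f subr_lt0.
have f0 : 0 <= f 0 by rewrite /f !phi0 subr_ge0.
have [|s] := IVT t0 cf (v := 0).
  by rewrite ge_min le_max f0 (ltW ft) orbT.
rewrite in_itv/= => /andP[s0 st] /eqP; rewrite subr_eq0 => /eqP meet.
have := cocycle s (t - s) w x s0; have := cocycle s (t - s) w y s0.
rewrite subrK subr_ge0 => /(_ st) ey /(_ st) ex.
by move: yx; rewrite ex ey meet ltxx.
Qed.

Lemma stopped_one d' (T' : measurableType d') (X : R -> T' -> 1.-tuple R) :
  stopped X = X.
Proof.
apply/funext => t; apply/funext => w; rewrite /stopped /meeting_time.
rewrite (_ : [set t | _ /\ _] = set0) ?image_set0 ?ereal_inf0.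
  by rewrite min_l ?leey.
by apply/seteqP; split => // s [_ [i [j [+ _]]]]; rewrite (ord1 i) (ord1 j) eqxx.
Qed.

(** The semigroup of one coalescing Wiener process is only known through the
    comparison of its paths with those of a Wiener process: this is where the
    existence of a Wiener process with continuous paths is used. *)
Lemma phi_law t x B : 0 < t -> measurable B ->
  P [set w | B (phi t w x)] = gauss [set z | B (x + Num.sqrt t * z)].
Proof.
move=> t0 mB; have [d' [S [P' [W [mW W0 cW indW]]]]] := brownian_motion_exists R.
have [[_ th0 _ _] _ _ [_ Feller] cphi] := Hphi.
have FX := Feller 0 1%N (tuple1 x) isT.
have [_ _ _ HQ4] := HQ.
have FX' := brownian_Feller x mW W0 indW.
have cX : continuous_paths
    (fun t w => [tuple phi (0 + t - 0) (theta 0 w) (tnth (tuple1 x) i) | i < 1]).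
  move=> w i.
  rewrite (_ : (fun t => _) = (fun t => phi t w x)); first exact: cphi.
  by apply/funext => s; rewrite !tnth_mktuple th0 add0r subr0.
have cX' : continuous_paths (fun t w => tuple1 (x + W t w)).
  move=> w i.
  rewrite (_ : (fun t => _) = (fun t => x + W t w)); last first.
    by apply/funext => s; rewrite tnth_mktuple.
  apply: continuous_subspaceT => s; apply: (@cvgD _ R^o); first exact: cvg_cst.
  exact: cW.
have := HQ4 1%N (tuple1 x) _ _ T S P P' _ _ isT FX cX FX' cX'.
rewrite !stopped_one => same.
pose B1 : set (1.-tuple (1.-tuple R)) := [set u | B (thead (thead u))].
have mB1 : measurable B1.
  rewrite -[X in measurable X]setTI.
  have : measurable_fun setT (fun u : 1.-tuple (1.-tuple R) => thead (thead u)).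
    by apply: measurableT_comp; exact: measurable_tnth.
  exact.
have := same 1%N (fun=> t) B1 (fun=> ltW t0) mB1.
rewrite (_ : [set w | _] = [set w | B (phi t w x)]); last first.
  by apply/seteqP; split => w; rewrite /B1/= /thead !tnth_mktuple th0 add0r subr0.
move=> ->.
have mz : measurable [set z | B (x + Num.sqrt t * z)].
  rewrite -[X in measurable X]setTI.
  have : measurable_fun setT (fun z => x + Num.sqrt t * z).
    by apply: measurable_funD => //; exact: measurable_funM.
  exact.
have FT : <<s [set W u @^-1` B | u in [set u | 0 <= u <= 0] & B in measurable] >> setT.
  by move=> G [[G0 GC _] _]; rewrite -setC0 -setTD; exact: GC.
have := indW 0 t (lexx 0) t0 setT _ FT mz.
rewrite setTI probability_setT mul1e => <-.
congr (P' _); apply/seteqP; split => w; rewrite /B1/= /thead !tnth_mktuple;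
  by rewrite add0r W0 subr0 mulrC divfK// gt_eqF// sqrtr_gt0.
Qed.

Lemma measurable_phi t x : 0 <= t -> measurable_fun setT (fun w => phi t w x).
Proof.
move=> t0; have [[_ th0 _ _] _ _ [_ Feller] _] := Hphi.
have [mX _ _] := Feller 0 1%N (tuple1 x) isT.
have := measurableT_comp (measurable_tnth ord0) (mX t t0).
rewrite (_ : _ \o _ = (fun w => phi t w x))//.
by apply/funext => w /=; rewrite !tnth_mktuple th0 add0r subr0.
Qed.

End arratia.

Lemma gauss_ray_gt0 (R : realType) : (0 < @normal_prob R 0 1 `]1%R, +oo[%classic)%E.
Proof.
have p0 : 0 < @normal_pdf R 0 1 2.
  by rewrite pdfE mulr_gt0 ?expR_gt0// normal_peak_gt0// oner_neq0.
apply: (@lt_le_trans _ _ (normal_prob 0 1 `]1%R, 2%R]%classic)); last first.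
  apply: le_measure; rewrite ?inE//; exact: subset_itvl.
apply: (@lt_le_trans _ _ (\int[lebesgue_measure]_(x in `]1%R, 2%R]) (@normal_pdf R 0 1 2)%:E)%E).
  rewrite integral_cst//= lebesgue_measure_itv/= lte_fin ltr1n -EFinB.
  by rewrite -EFinM lte_fin mulr_gt0//; lra.
apply: ge0_le_integral => //.
- by move=> x _; rewrite lee_fin ltW.
- apply: measurable_funTS; apply/measurable_EFinP; exact: measurable_normal_pdf.
move=> x /=; rewrite in_itv/= => /andP[x1 x2]; rewrite lee_fin !pdfE.
rewrite ler_pM2l ?normal_peak_gt0 ?oner_neq0// ler_expR.
rewrite ler_pM2r ?invr_gt0// lerN2 ler_sqr ?nnegrE//.
by rewrite (le_trans _ (ltW x1)).
Qed.

Lemma tail_small d (T : measurableType d) (R : realType) (P : probability T R)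
    (eta : {RV P >-> R}) (e : \bar R) : (0 < e)%E ->
  exists2 M : R, 0 < M & (P [set w | M < `|eta w|]%R < e)%E.
Proof.
move=> e0.
have mF n : measurable [set w | n.+1%:R < `|eta w|].
  rewrite (_ : [set w | _] = (fun w => `|eta w|) @^-1` `]n.+1%:R, +oo[).
    rewrite -[X in measurable X]setTI.
    have mn : measurable_fun setT (fun w => `|eta w|) by exact: measurableT_comp.
    by apply: mn => //; exact: measurable_itv.
  by apply/seteqP; split => w /=; rewrite in_itv/= andbT.
have : P [set w | n.+1%:R < `|eta w|] @[n --> \oo] -->
    P (\bigcap_n [set w | n.+1%:R < `|eta w|]).
  apply: nonincreasing_cvg_mu => //.
  - by rewrite (le_lt_trans (probability_le1 _ _))// ltry.
  - exact: bigcapT_measurable.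
  - move=> i j ij; apply/subsetPset => w /=; apply: le_lt_trans.
    by rewrite ler_nat.
rewrite (_ : \bigcap_n _ = set0) ?measure0; last first.
  apply/seteqP; split => // w /(_ (Num.truncn `|eta w|) I) /=.
  by rewrite ltNge ltW// truncnS_gt.
move=> cvgF; apply: contrapT => /forall2NP H.
have : (e <= 0)%E; last by rewrite leNgt e0.
rewrite -(cvg_lim _ cvgF)//; apply: lime_ge.
  by apply/cvg_ex; exists 0%E.
apply: nearW => n; rewrite leNgt; apply/negP => Fn.
by case: (H n.+1%:R) => //; apply.
Qed.

Theorem theorem3p1 (R : realType)
    (Q : forall n : nat, R -> R.-pker (n.-tuple R) ~> (n.-tuple R))
    (HQ : coalescing_semigroups Q)
    (d : measure_display) (T : measurableType d) (P : probability T R)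
    (theta : R -> T -> T) (phi : R -> T -> R -> R)
    (Hphi : Arratia_rds P Q theta phi) :
  ~ exists eta : {RV P >-> R}, stationary_point theta phi eta.
Proof.
case=> h; case=> Omega0; case=> mO PO _ stat.
have [[mtheta _ _ Ptheta] _ _ _ _] := Hphi.
have [e e0 ele] : exists2 e : R, 0 < e &
    (e%:E + e%:E <= @normal_prob R 0 1 `]1%R, +oo[%classic)%E.
  have := gauss_ray_gt0 R; set g := normal_prob _ _ _.
  have gE : g = (fine g)%:E by rewrite fineK// fin_num_measure.
  rewrite gE lte_fin => g0; exists (fine g / 2); first by rewrite divr_gt0.
  by rewrite -EFinD -splitr.
have e0' : (0 < e%:E)%E by rewrite lte_fin.
have [M M0 PM] := tail_small h e0'.
pose t := (2 * M) ^+ 2.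
have t0 : 0 < t by rewrite exprn_gt0// mulr_gt0.
have law := phi_law HQ Hphi (- M) t0 (measurable_itv `]M, +oo[).
have : P [set w | `]M, +oo[%classic (phi t w (- M))] = normal_prob 0 1 `]1%R, +oo[%classic.
  rewrite law; congr (normal_prob 0 1 _); apply/seteqP; split => z /=;
  rewrite !in_itv/= !andbT /t sqrtr_sqr ger0_norm ?mulr_ge0 ?(ltW M0)//.
    by move=> Mz; rewrite -(ltr_pM2l M0); lra.
  move=> z1; have : M * 1 < M * z by rewrite ltr_pM2l.
  by lra.
move=> lawE.
have mtheta_t : measurable_fun setT (theta t).
  by apply: (measurableT_comp mtheta (measurable_pair1 t)).
pose F := [set w | M < `|h w|].
have mF : measurable F.
  rewrite (_ : F = (fun w => `|h w|) @^-1` `]M, +oo[).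
    rewrite -[X in measurable X]setTI.
    have mn : measurable_fun setT (fun w => `|h w|) by exact: measurableT_comp.
    by apply: mn => //; exact: measurable_itv.
  by apply/seteqP; split => w /=; rewrite in_itv/= andbT.
have mG : measurable (theta t @^-1` F).
  by rewrite -[X in measurable X]setTI; exact: mtheta_t.
have sub : [set w | `]M, +oo[%classic (phi t w (- M))] `<=`
    F `|` theta t @^-1` F `|` ~` Omega0.
  move=> w /=; rewrite in_itv/= andbT => Mphi.
  have [Ow|] := pselect (Omega0 w); last by right.
  left; have [Feta|Feta] := ltP M `|h w|; first by left.
  right; rewrite /F/= -stat// ?(ltW t0)//.
  apply: (lt_le_trans Mphi); apply: (le_trans _ (ler_norm _)).
  apply: (phi_monotone Hphi _ (ltW t0)).
  by move: Feta; rewrite ler_norml => /andP[].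
pose V := [set w | `]M, +oo[%classic (phi t w (- M))].
have : (P V < e%:E + e%:E)%E.
  apply: (@le_lt_trans _ _ (P (F `|` theta t @^-1` F `|` ~` Omega0))).
    apply: le_measure; rewrite ?inE//.
      have := measurable_phi Hphi (- M) (ltW t0) measurableT (measurable_itv `]M, +oo[).
      by rewrite setTI.
    by apply: measurableU; [exact: measurableU|exact: measurableC].
  have PO0 : P (~` Omega0) = 0%E by rewrite probability_setC// PO subee.
  rewrite measureU0//; last 2 first.
  - exact: measurableU.
  - exact: measurableC.
  have PG : (P (theta t @^-1` F) < e%:E)%E by rewrite Ptheta.
  exact: (le_lt_trans (measureU2 P mF mG) (lteD PM PG)).
by rewrite lawE ltNge ele.
Qed.
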